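(* Let $b_1,b_2$ be complex parameters such that $2b_1$, $2b_2$ and $b_1+\frac12$ are not zero or negative integers. Then for $(s,t)$ in a neighborhood of $(0,0)$ in $\mathbf C^2$, $$F_2\!\left(b_1+b_2-\tfrac12;\,b_1,b_2;\,2b_1,2b_2;\;\frac{4(1-s^2)\,t}{(1+s+t-st)^2},\;\frac{4(1-t^2)\,s}{(1+s+t-st)^2}\right)$$ $$=\left(\frac{1+s+t-st}{1-s}\right)^{2b_1+2b_2-1}{}_2F_1\!\left(b_1+b_2-\tfrac12,\,b_2;\;2b_2;\;-\frac{4s}{(s-1)^2}\right)\,{}_2F_1\!\left(b_1+b_2-\tfrac12,\,b_2;\;b_1+\tfrac12;\;t^2\right),$$ where the power function takes the value $1$ at $(s,t)=(0,0)$.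
   Context: $(\alpha)_n=\alpha(\alpha+1)\cdots(\alpha+n-1)$. Appell's series is $$F_2(a;b_1,b_2;c_1,c_2;x,y)=\sum_{n,m\ge 0}\frac{(a)_{n+m}(b_1)_n(b_2)_m}{(c_1)_n(c_2)_m\,n!\,m!}x^ny^m ,$$ convergent for $|x|+|y|<1$, and ${}_2F_1(A,B;C;z)=\sum_{n\ge0} \frac{(A)_n(B)_n}{(C)_n n!}z^n$ for $|z|<1$. *)

(* Defs.v *)
From Stdlib Require Import Reals Factorial List Lra.
From Coquelicot Require Import Coquelicot.
Open Scope C_scope.

Fixpoint poch (a : C) (n : nat) : C :=
  match n with
  | O => 1
  | S k => poch a k * (a + INR k)
  end.

Definition not_nonpos_int (z : C) : Prop := forall n : nat, z <> - INR n.

Definition sum_list (u : nat * nat -> C) (S : list (nat * nat)) : C :=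
  fold_right (fun p acc => u p + acc) (RtoC 0) S.

(* Unconditional convergence of a double series: the sums over finite index
   sets (duplicate-free lists), directed by inclusion, converge to [l]. *)
Definition is_double_series (u : nat * nat -> C) (l : C) : Prop :=
  forall eps : R, (0 < eps)%R ->
  exists S0 : list (nat * nat), NoDup S0 /\
    forall S : list (nat * nat), NoDup S -> incl S0 S ->
      (Cmod (sum_list u S - l) < eps)%R.

Definition appellF2_term (a b1 b2 c1 c2 x y : C) (p : nat * nat) : C :=
  let (n, m) := p in
  poch a (n + m) * poch b1 n * poch b2 m
    / (poch c1 n * poch c2 m * INR (fact n) * INR (fact m)) * x ^ n * y ^ m.

Definition is_appellF2 (a b1 b2 c1 c2 x y l : C) : Prop :=
  is_double_series (appellF2_term a b1 b2 c1 c2 x y) l.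

Definition hyp2F1_term (A B D z : C) (n : nat) : C :=
  poch A n * poch B n / (poch D n * INR (fact n)) * z ^ n.

Definition is_hyp2F1 (A B D z l : C) : Prop :=
  is_series (hyp2F1_term A B D z) l.

Definition Cexp (z : C) : C :=
  ((exp (Re z) * cos (Im z))%R, (exp (Re z) * sin (Im z))%R).

(* Principal argument, with values in (-PI, PI]. *)
Definition Carg (z : C) : R :=
  (if Rlt_dec 0 (Re z) then atan (Im z / Re z)
   else if Rlt_dec 0 (Im z) then PI / 2 - atan (Re z / Im z)
   else if Rlt_dec (Im z) 0 then - PI / 2 - atan (Re z / Im z)
   else PI)%R.

Definition Clog (z : C) : C := (ln (Cmod z), Carg z).

(* Principal branch for z <> 0: holomorphic off the nonpositive real axis,
   with value 1 at z = 1. *)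
Definition Cpower (z a : C) : C := Cexp (a * Clog z).

Lemma Cpower_1_l (a : C) : Cpower 1 a = 1.
Proof.
  assert (H : Clog 1 = 0).
  { unfold Clog, Carg; rewrite Cmod_1, ln_1; simpl.
    destruct (Rlt_dec 0 1) as [_ | H]; [| lra].
    unfold Rdiv; rewrite Rmult_0_l, atan_0; reflexivity. }
  unfold Cpower; rewrite H, Cmult_0_r.
  unfold Cexp; simpl; rewrite exp_0, cos_0, sin_0, Rmult_1_l, Rmult_0_r.
  reflexivity.
Qed.

(* Main.v *)
Require Import Defs.
From Stdlib Require Import Reals Factorial Lra Lia List Permutation Classical ClassicalEpsilon.
From Coquelicot Require Import Coquelicot.
Open Scope C_scope.

(** Put [a = b1 + b2 - 1/2], [sigma = (1 + s) / (1 - s)], [z = t / sigma],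
    [X = 1 - 1 / sigma^2] and [Y = t^2].  The arguments of [F2] become
    [4 z / (1 + z)^2] and [X (1 - Y) / (1 + z)^2], and [z^2 = Y (1 - X)].
    Expanding the powers of [1 + z] and collecting powers of [z], Watson's
    terminating sum turns [F2] into [(1 + z)^(2a)] times Appell's
    [F4(a, b2; 2 b2, b1 + 1/2; X (1 - Y), Y (1 - X))].  Since
    [2 b2 + (b1 + 1/2) = a + b2 + 1], Bailey's theorem factors this [F4] as
    [2F1(a, b2; 2 b2; X) 2F1(a, b2; b1 + 1/2; Y)]; comparing the coefficients
    of [X^i Y^j], it amounts to the sums of Chu-Vandermonde and Saalschutz.
    Pfaff's transformation [X -> X / (X - 1) = 1 - sigma^2] of the first factor
    and [sigma (1 + z) = sigma + t] conclude.  Near the origin every family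
    involved is dominated by a geometric one, hence absolutely summable. *)

(** * Finite hypergeometric sums *)

(** Every infinite identity follows one scheme: a single family in two, three or four indices is
    bounded once, then summed along two partitions of its index set. One partition rebuilds the
    powers of [1 + z], [1 - X] or [1 - Y]; the other leaves a terminating sum. Convergence is
    therefore that of finite sums directed by inclusion, for which no order of summation is
    preferred and regrouping is a single lemma, [asum_fiber].

    Two coincidences of parameters make the steps fit. Watson's sum at [A = a + m] produces
    [(A - b1 + 1/2)_k]; as [a - b1 + 1/2 = b2], this is [(b2 + m)_k], which fuses with [(b2)_m] into
    the [(b2)_(m+k)] of an F4. For that F4, [g + g' - 1 = al + be] makes the inner Chu-Vandermonde
    sum depend on [g], [g'] only through the factors [1 / ((g)_i (g')_j)] of the expected product.

    The claim is local, so quotients of Pochhammer symbols are simply bounded by powers of a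
    constant, at the price of small radii. The powers are principal ones: near 1 all arguments are
    small, so [Clog] is additive there. *)

Fixpoint csum (f : nat -> C) (n : nat) : C :=
  match n with
  | O => 0
  | S k => csum f k + f k
  end.

(** The summand receives both indices, so that factorials and powers of [n - k] are written without
    subtraction and the recurrences below treat the two indices alike. *)
Definition antidiag (F : nat -> nat -> C) (n : nat) : C :=
  csum (fun k => F k (n - k)%nat) (S n).

Definition cfact (n : nat) : C := INR (fact n).

Lemma csum_ext f g n : (forall k, (k < n)%nat -> f k = g k) -> csum f n = csum g n.
Proof.
  induction n as [|n IH]; intros H; simpl; [reflexivity|].
  rewrite IH, H by (intros; try apply H; lia); reflexivity.
Qed.

Lemma csum_plus f g n : csum (fun k => f k + g k) n = csum f n + csum g n.
Proof. induction n as [|n IH]; simpl; [ring | rewrite IH; ring]. Qed.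

Lemma csum_scal c f n : csum (fun k => c * f k) n = c * csum f n.
Proof. induction n as [|n IH]; simpl; [ring | rewrite IH; ring]. Qed.

Lemma csum_recl f n : csum f (S n) = f O + csum (fun k => f (S k)) n.
Proof. induction n as [|n IH]; [simpl; ring | simpl in *; rewrite IH; ring]. Qed.

Lemma antidiag_ext F G n :
  (forall k d, (k + d = n)%nat -> F k d = G k d) -> antidiag F n = antidiag G n.
Proof. intros H; apply csum_ext; intros k Hk; apply H; lia. Qed.

Lemma antidiag_plus F G n :
  antidiag (fun k d => F k d + G k d) n = antidiag F n + antidiag G n.
Proof. apply csum_plus. Qed.

Lemma antidiag_scal c F n : antidiag (fun k d => c * F k d) n = c * antidiag F n.
Proof. apply csum_scal. Qed.

Lemma antidiag_recl F n :
  antidiag F (S n) = F O (S n) + antidiag (fun k d => F (S k) d) n.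
Proof. unfold antidiag; rewrite csum_recl; reflexivity. Qed.

Lemma antidiag_recr F n :
  antidiag F (S n) = antidiag (fun k d => F k (S d)) n + F (S n) O.
Proof.
  unfold antidiag; change (csum ?f (S (S n))) with (csum f (S n) + f (S n)); cbv beta.
  rewrite Nat.sub_diag; f_equal; apply csum_ext; intros k Hk.
  replace (S n - k)%nat with (S (n - k)) by lia; reflexivity.
Qed.

Lemma RtoC_neq (x y : R) : x <> y -> RtoC x <> RtoC y.
Proof. intros H E; apply H, RtoC_inj, E. Qed.

Lemma RtoC_INR_S n : RtoC (INR (S n)) = INR n + 1.
Proof. rewrite S_INR, RtoC_plus; reflexivity. Qed.

Lemma RtoC_INR_plus n m : RtoC (INR (n + m)) = INR n + INR m.
Proof. rewrite plus_INR, RtoC_plus; reflexivity. Qed.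

Lemma INR_S_neq0 n : INR n + 1 <> (0 : C).
Proof.
  rewrite <- RtoC_INR_S; intros H; apply RtoC_inj in H; revert H; apply not_0_INR; lia.
Qed.

Lemma cfact_S n : cfact (S n) = (INR n + 1) * cfact n.
Proof.
  unfold cfact; rewrite fact_simpl, mult_INR, RtoC_mult, RtoC_INR_S; reflexivity.
Qed.

Lemma cfact_0 : cfact 0 = 1.
Proof. reflexivity. Qed.

Lemma cfact_neq0 n : cfact n <> 0.
Proof. intros H; apply RtoC_inj in H; revert H; apply INR_fact_neq_0. Qed.

Lemma poch_S a n : poch a (S n) = poch a n * (a + INR n).
Proof. reflexivity. Qed.

Lemma poch_add a n m : poch a (n + m) = poch a n * poch (a + INR n) m.
Proof.
  induction m as [|m IH].
  - rewrite Nat.add_0_r; simpl; ring.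
  - rewrite Nat.add_succ_r, !poch_S, IH, RtoC_INR_plus; ring.
Qed.

Lemma poch_recl a n : poch a (S n) = a * poch (a + 1) n.
Proof. change (S n) with (1 + n)%nat; rewrite poch_add; simpl; ring. Qed.

Lemma not_nonpos_int_add_neq0 d n : not_nonpos_int d -> d + INR n <> 0.
Proof.
  intros H E; apply (H n); replace d with (d + INR n - INR n) by ring; rewrite E; ring.
Qed.

Lemma poch_neq0 d n : not_nonpos_int d -> poch d n <> 0.
Proof.
  intros H; induction n as [|n IH]; simpl.
  - apply RtoC_neq; lra.
  - apply Cmult_neq_0; [assumption | apply not_nonpos_int_add_neq0; assumption].
Qed.

Lemma poch_1 n : poch 1 n = cfact n.
Proof.
  induction n as [|n IH]; [reflexivity|]. rewrite poch_S, IH, cfact_S; ring.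
Qed.

Ltac nz := repeat (split || assumption || apply cfact_neq0 || apply INR_S_neq0
  || (apply poch_neq0; assumption) || (apply not_nonpos_int_add_neq0; assumption)
  || (apply RtoC_neq; lra)
  || (rewrite <- RtoC_INR_plus; apply not_nonpos_int_add_neq0; assumption)
  || (rewrite <- Cplus_assoc, <- RtoC_INR_plus; apply not_nonpos_int_add_neq0; assumption)).

Definition bsum (h : nat -> nat -> C) (n : nat) : C :=
  antidiag (fun k d => h k d / (cfact k * cfact d)) n.

(* Pascal's rule, the factorials being kept in the denominators. *)
Lemma bsum_S h n :
  (INR n + 1) * bsum h (S n)
  = bsum (fun k d => h (S k) d) n + bsum (fun k d => h k (S d)) n.
Proof.
  unfold bsum.
  transitivity (antidiag (fun k d => INR k * (h k d / (cfact k * cfact d))) (S n)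
    + antidiag (fun k d => INR d * (h k d / (cfact k * cfact d))) (S n)).
  - rewrite <- antidiag_plus, <- antidiag_scal; apply antidiag_ext; intros k d H.
    rewrite <- RtoC_INR_S, <- H, RtoC_INR_plus; ring.
  - rewrite antidiag_recl, antidiag_recr.
    replace (RtoC (INR 0)) with (RtoC 0) by reflexivity.
    rewrite !Cmult_0_l, Cplus_0_l, Cplus_0_r; f_equal; apply antidiag_ext; intros k d _;
      rewrite RtoC_INR_S, cfact_S; field; nz.
Qed.

Lemma bsum_eq_step h n l :
  bsum (fun k d => h (S k) d) n + bsum (fun k d => h k (S d)) n = (INR n + 1) * l ->
  bsum h (S n) = l.
Proof.
  rewrite <- bsum_S; intros H.
  replace (bsum h (S n)) with ((INR n + 1) * bsum h (S n) / (INR n + 1)) by (field; nz).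
  rewrite H; field; nz.
Qed.

Lemma bsum_ext h g n :
  (forall k d, (k + d = n)%nat -> h k d = g k d) -> bsum h n = bsum g n.
Proof. intros H; apply antidiag_ext; intros k d E; rewrite H by assumption; reflexivity. Qed.

(** The shift [p] closes the induction: Pascal's rule turns order [n + 1] into order [n] at [p + 1],
    with a sign, and at [p]. For [p = 0] this is Chu-Vandermonde's value of [2F1(-n, d; c; 1)]. *)
Lemma bsum_vandermonde_sign d c n p : not_nonpos_int c ->
  bsum (fun k _ => (-(1)) ^ k * poch d (p + k) / poch c (p + k)) n
  = poch d p * poch (c - d) n / (poch c (p + n) * cfact n).
Proof.
  intros hc; revert p; induction n as [|n IH]; intros p.
  - unfold bsum, antidiag; simpl; rewrite !cfact_0, Nat.add_0_r; field; nz.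
  - apply bsum_eq_step.
    rewrite (bsum_ext _ (fun k _ => -(1) *
      ((-(1)) ^ k * poch d (S p + k) / poch c (S p + k)))).
    2:{ intros k e _; replace (p + S k)%nat with (S p + k)%nat by lia; rewrite Cpow_S; unfold Cdiv; ring. }
    replace (bsum (fun k _ => -(1) * ((-(1)) ^ k * poch d (S p + k) / poch c (S p + k))) n)
      with (-(1) * bsum (fun k _ => (-(1)) ^ k * poch d (S p + k) / poch c (S p + k)) n).
    2:{ unfold bsum; rewrite <- antidiag_scal; apply antidiag_ext; intros; unfold Cdiv; ring. }
    rewrite !IH, Nat.add_succ_r; change (S p + n)%nat with (S (p + n)).
    rewrite !poch_S, cfact_S, RtoC_INR_plus; field; nz.
Qed.

(** Chu-Vandermonde with both symbols in the denominator. The offsets [i] and [j] absorb the two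
    halves of Pascal's rule; both halves carry the same numerator symbol, so only linear factors
    remain to be compared. *)
Lemma bsum_vandermonde_inv g g' i j l : not_nonpos_int g -> not_nonpos_int g' ->
  bsum (fun p r => / (poch g (p + i) * poch g' (r + j))) l
  = poch (g + g' - 1 + INR (i + j + l)) l
    / (poch g (i + l) * poch g' (j + l) * cfact l).
Proof.
  intros hg hg'; revert i j; induction l as [|l IH]; intros i j.
  - unfold bsum, antidiag; simpl; rewrite !cfact_0, !Nat.add_0_r; field; nz.
  - apply bsum_eq_step.
    rewrite (bsum_ext (fun k d => / (poch g (S k + i) * poch g' (d + j)))
      (fun k d => / (poch g (k + S i) * poch g' (d + j)))).
    2:{ intros; do 3 f_equal; lia. }
    rewrite (bsum_ext (fun k d => / (poch g (k + i) * poch g' (S d + j)))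
      (fun k d => / (poch g (k + i) * poch g' (d + S j)))).
    2:{ intros; do 3 f_equal; lia. }
    rewrite !IH.
    replace (S i + j + l)%nat with (i + j + S l)%nat by lia.
    replace (i + S j + l)%nat with (i + j + S l)%nat by lia.
    rewrite !Nat.add_succ_r; change (S i + l)%nat with (S (i + l)).
    change (S j + l)%nat with (S (j + l)).
    rewrite !(poch_S _ (_ + l)), (poch_S _ l), cfact_S, !RtoC_INR_S, !RtoC_INR_plus.
    field; nz.
Qed.

(** * Creative telescoping: the sums of Saalschutz and Watson *)

Lemma antidiag_telescope F E n :
  F O n = E O n ->
  (forall k d, (k + S d = n)%nat -> F (S k) d = E (S k) d - E k (S d)) ->
  antidiag F n = E n O.
Proof.
  intros H0 H.
  assert (G : forall k, (k <= n)%nat -> csum (fun k => F k (n - k)%nat) (S k) = E k (n - k)%nat).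
  { induction k as [|k IH]; intros Hk.
    - simpl; rewrite Nat.sub_0_r, H0; ring.
    - change (csum ?f (S (S k))) with (csum f (S k) + f (S k)); cbv beta.
      rewrite IH, H by lia; replace (n - k)%nat with (S (n - S k)) by lia; ring. }
  unfold antidiag; rewrite G, Nat.sub_diag by lia; reflexivity.
Qed.

(** Saalschutz's summand cleared of its lower parameters, so that the evaluation is a polynomial
    identity in [a], [b], [x] and needs no restriction on them. *)
Definition saalschutz_term (a b x : C) (l d : nat) : C :=
  poch a d * poch b d * poch (a + b - x + INR d) l * poch (- x) l / (cfact l * cfact d).

(* Creative telescoping in [j]; the certificate is the function given to [antidiag_telescope]. *)
Lemma saalschutz a b x j :
  antidiag (saalschutz_term a b x) j = poch (a - x) j * poch (b - x) j / cfact j.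
Proof.
  induction j as [|j IH].
  { unfold antidiag, saalschutz_term; simpl; rewrite !cfact_0; field; nz. }
  assert (E : (INR j + 1) * antidiag (saalschutz_term a b x) (S j)
    = (a - x + INR j) * (b - x + INR j) * antidiag (saalschutz_term a b x) j).
  (* Splitting off the term [l = j + 1], [d = 0] aligns the others, [t k (S d)], with the terms
     [t k d] of order [j]; the combination of the two telescopes. *)
  { rewrite antidiag_recr.
    set (t := saalschutz_term a b x).
    assert (T : antidiag (fun k d => (INR j + 1) * t k (S d)
        - (a - x + INR j) * (b - x + INR j) * t k d) j
      = (a + b - x + INR 0 + INR j) * (x - INR j) * t j O).
    { apply (antidiag_telescope _
        (fun l d => (a + b - x + INR d + INR j) * (x - INR l) * t l d)).
      - unfold t, saalschutz_term; cbv beta; rewrite !poch_S, !cfact_S, cfact_0; simpl poch.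
        simpl (INR 0); field; nz.
      - intros k d H; rewrite <- H, RtoC_INR_plus, RtoC_INR_S.
        assert (R : poch (a + b - x + INR d) (S k)
          = (a + b - x + INR d) * poch (a + b - x + INR (S d)) k).
        { rewrite poch_recl, RtoC_INR_S; do 2 f_equal; ring. }
        assert (R' : poch (a + b - x + INR (S d)) (S k)
          = poch (a + b - x + INR (S d)) k * (a + b - x + INR d + 1 + INR k)).
        { rewrite poch_S, RtoC_INR_S; ring. }
        unfold t, saalschutz_term; rewrite R, R', !(poch_S _ d), !(poch_S _ k), !cfact_S.
        rewrite !RtoC_INR_S; field; nz. }
    assert (T' : (INR j + 1) * antidiag (fun k d => t k (S d)) j
      - (a - x + INR j) * (b - x + INR j) * antidiag t j
      = (a + b - x + INR 0 + INR j) * (x - INR j) * t j O).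
    { rewrite <- T, <- !antidiag_scal; unfold Cminus at 1.
      replace (- antidiag (fun k d => (a - x + INR j) * (b - x + INR j) * t k d) j)
        with (-(1) * antidiag (fun k d => (a - x + INR j) * (b - x + INR j) * t k d) j) by ring.
      rewrite <- antidiag_scal, <- antidiag_plus; apply antidiag_ext; intros; ring. }
    rewrite Cmult_plus_distr_l.
    replace ((INR j + 1) * antidiag (fun k d => t k (S d)) j) with
      ((a + b - x + INR 0 + INR j) * (x - INR j) * t j O
       + (a - x + INR j) * (b - x + INR j) * antidiag t j) by (rewrite <- T'; ring).
    unfold t at 1 3, saalschutz_term; rewrite !poch_S, !cfact_S, cfact_0; simpl (INR 0); field; nz. }
  replace (antidiag (saalschutz_term a b x) (S j))
    with ((INR j + 1) * antidiag (saalschutz_term a b x) (S j) / (INR j + 1)) by (field; nz).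
  rewrite E, IH, !poch_S, cfact_S; field; nz.
Qed.

(** Its antidiagonal sum of order [N] is the coefficient of [z^N] in
    [(1 + z)^(-2A) 2F1(A, b; 2b; 4z/(1+z)^2)], the power [(1 + z)^(-2A-2n)] being expanded with
    index [d]. The evaluations below are thus Gauss's quadratic transformation, with value
    [2F1(A, A - b + 1/2; b + 1/2; z^2)]. The recurrence has step two, which separates even from odd
    [N]. *)
Definition watson_term (A b : C) (n d : nat) : C :=
  (-(1)) ^ d * poch A n * 4 ^ n * poch (2 * A + 2 * INR n) d * poch b n
  / (poch (2 * b) n * cfact n * cfact d).

(* Creative telescoping in [N], with certificate [E]. *)
Lemma watson_rec A b N : not_nonpos_int (2 * b) ->
  (INR N + 2) * (INR N + 1 + 2 * b) * antidiag (watson_term A b) (S (S N))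
  = (2 * A + INR N) * (2 * A - 2 * b + 1 + INR N) * antidiag (watson_term A b) N.
Proof.
  intros hb.
  rewrite !antidiag_recr.
  set (t := watson_term A b).
  set (p := (INR N + 2) * (INR N + 1 + 2 * b)).
  set (q := (2 * A + INR N) * (2 * A - 2 * b + 1 + INR N)).
  set (E := fun n d => 4 * (t n d / ((INR d + 1) * (INR d + 2))) * (b + INR n)
        * (INR d + 2) * (2 * A + INR N + INR n) * (A + INR N + 1)).
  assert (T : antidiag (fun k d => p * t k (S (S d)) - q * t k d) N = E N O).
  { apply (antidiag_telescope _ E).
    - unfold E, t, watson_term, p, q.
      rewrite !poch_S, !cfact_S, cfact_0, !Cpow_S; simpl poch; rewrite !RtoC_INR_S.
      simpl (INR 0); simpl Cpow; field; nz.
      replace (INR N + 2) with (INR (S N) + 1) by (rewrite RtoC_INR_S; ring); nz.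
    - intros k d H; unfold E, p, q; rewrite <- H, RtoC_INR_plus, !RtoC_INR_S.
      (* As [N = k + d + 1], the factor [2A + N + k] of [E k (S d)] is the next factor of
         [(2A + 2k)_(d+1)]. Absorbing it lets the symbol be rebased at [2A + 2(k+1)] without
         dividing by a quantity that may vanish. *)
      assert (R : poch (2 * A + 2 * INR k) (S d) * (2 * A + 2 * INR k + 1 + INR d)
        = (2 * A + 2 * INR k) * (2 * A + 2 * INR k + 1) * poch (2 * A + 2 * INR (S k)) d).
      { transitivity (poch (2 * A + 2 * INR k) (S (S d))).
        - rewrite (poch_S _ (S d)), RtoC_INR_S; ring.
        - rewrite !poch_recl, RtoC_INR_S, Cmult_assoc; f_equal; f_equal; ring. }
      assert (R' : t k (S d) * (2 * A + (INR k + (INR d + 1)) + INR k)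
        = - ((-(1)) ^ d * poch A k * 4 ^ k * poch b k * ((2 * A + 2 * INR k)
          * (2 * A + 2 * INR k + 1) * poch (2 * A + 2 * INR (S k)) d))
          / (poch (2 * b) k * cfact k * cfact (S d))).
      { rewrite <- R; unfold t, watson_term; rewrite Cpow_S; field; nz. }
      replace (4 * (t k (S d) / ((INR d + 1 + 1) * (INR d + 1 + 2))) * (b + INR k)
        * (INR d + 1 + 2) * (2 * A + (INR k + (INR d + 1)) + INR k)
        * (A + (INR k + (INR d + 1)) + 1))
      with (4 * ((t k (S d) * (2 * A + (INR k + (INR d + 1)) + INR k))
        / ((INR d + 1 + 1) * (INR d + 1 + 2))) * (b + INR k)
        * (INR d + 1 + 2) * (A + (INR k + (INR d + 1)) + 1))
      by (unfold Cdiv; ring).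
      rewrite R'; unfold t, watson_term.
      rewrite !(poch_S _ (S d)), !(poch_S _ d), !(poch_S _ k), !cfact_S, !Cpow_S, !RtoC_INR_S.
      field; nz; try (replace (INR d + 1 + 2) with (INR (S (S d)) + 1)
        by (rewrite !RtoC_INR_S; ring); nz);
      try (replace (INR d + 2) with (INR (S d) + 1) by (rewrite !RtoC_INR_S; ring); nz);
      try (replace (INR d + 1 + 1) with (INR (S d) + 1) by (rewrite !RtoC_INR_S; ring); nz). }
  assert (T' : p * antidiag (fun k d => t k (S (S d))) N - q * antidiag t N = E N O).
  { rewrite <- T; unfold Cminus at 1.
    replace (- (q * antidiag t N)) with (- q * antidiag t N) by ring.
    rewrite <- !antidiag_scal, <- antidiag_plus; apply antidiag_ext; intros; ring. }
  replace (q * antidiag t N) with (p * antidiag (fun k d => t k (S (S d))) N - E N O)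
    by (rewrite <- T'; ring).
  (* Only the boundary is left: [p] times the two end terms split off at order [N + 2] must equal
     [- E N O]. *)
  unfold E; rewrite Cmult_plus_distr_l, Cmult_plus_distr_l.
  unfold Cminus; rewrite <- Cplus_assoc; f_equal.
  unfold t, watson_term, p; rewrite !poch_S, !cfact_S, cfact_0, !Cpow_S, !RtoC_INR_S.
  simpl poch; simpl (INR 0); simpl Cpow; field; nz.
  all: try (rewrite <- RtoC_INR_S; nz).
Qed.

Lemma watson_even A b k : not_nonpos_int (2 * b) -> not_nonpos_int (b + 1 / 2) ->
  antidiag (watson_term A b) (2 * k)
  = poch A k * poch (A - b + 1 / 2) k / (poch (b + 1 / 2) k * cfact k).
Proof.
  intros hb hb'; induction k as [|k IH].
  { unfold antidiag, watson_term; simpl; rewrite !cfact_0; field; nz. }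
  replace (2 * S k)%nat with (S (S (2 * k))) by lia.
  pose proof (watson_rec A b (2 * k) hb) as W; rewrite IH, mult_INR, RtoC_mult in W.
  replace (RtoC (INR 2)) with (RtoC 2) in W by reflexivity.
  pose proof (not_nonpos_int_add_neq0 _ k hb') as nz1.
  assert (nz2 : 2 * INR k + 1 + 2 * b <> 0).
  { replace (2 * INR k + 1 + 2 * b) with (2 * (b + 1 / 2 + INR k)) by field.
    apply Cmult_neq_0; nz. }
  assert (nz3 : 2 * INR k + 2 <> 0).
  { replace (2 * INR k + 2) with (2 * (INR k + 1)) by ring; apply Cmult_neq_0; nz. }
  replace (antidiag (watson_term A b) (S (S (2 * k)))) with
    ((2 * INR k + 2) * (2 * INR k + 1 + 2 * b) * antidiag (watson_term A b) (S (S (2 * k)))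
      / ((2 * INR k + 2) * (2 * INR k + 1 + 2 * b))) by (field; nz).
  rewrite W, !poch_S, cfact_S; field; nz.
  replace (b * 2 + 1 + INR k * 2) with (2 * INR k + 1 + 2 * b) by ring; assumption.
Qed.

Lemma watson_odd A b k : not_nonpos_int (2 * b) ->
  antidiag (watson_term A b) (S (2 * k)) = 0.
Proof.
  intros hb; induction k as [|k IH].
  (* For [N = 1] the two terms are [-2A] and [4Ab/(2b)], which cancel because [2b] is not zero. *)
  { unfold antidiag, watson_term; simpl; rewrite !cfact_S, !cfact_0; simpl (INR 0).
    pose proof (hb O) as h0; simpl in h0.
    field; intros E; apply h0; rewrite E; ring. }
  replace (S (2 * S k))%nat with (S (S (S (2 * k)))) by lia.
  pose proof (watson_rec A b (S (2 * k)) hb) as W; rewrite IH, Cmult_0_r in W.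
  assert (nz1 : INR (S (2 * k)) + 2 <> (0 : C)).
  { replace (INR (S (2 * k)) + 2) with (INR (S (S (2 * k))) + 1)
      by (rewrite !RtoC_INR_S; ring); nz. }
  assert (nz2 : INR (S (2 * k)) + 1 + 2 * b <> 0).
  { rewrite <- RtoC_INR_S, Cplus_comm; nz. }
  destruct (classic (antidiag (watson_term A b) (S (S (S (2 * k)))) = 0)) as [H|H]; [exact H|].
  exfalso; revert W; repeat apply Cmult_neq_0; assumption.
Qed.

Lemma poch_opp_INR i l : (l <= i)%nat ->
  poch (- INR i) l = (-(1)) ^ l * cfact i / cfact (i - l).
Proof.
  induction l as [|l IH]; intros H.
  - rewrite Nat.sub_0_r; simpl; field; nz.
  - rewrite poch_S, IH, Cpow_S by lia; replace (i - l)%nat with (S (i - S l)) by lia.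
    rewrite cfact_S.
    replace (RtoC (INR i)) with (INR (i - S l) + INR l + 1)
      by (rewrite <- RtoC_INR_plus, <- RtoC_INR_S; do 2 f_equal; lia).
    field; nz.
Qed.

(** Summed over [l], this is [(g)_i (g')_j] times the coefficient of [X^i Y^j] in
    [F4(al, be; g, g'; X(1-Y), Y(1-X))] when [g + g' = al + be + 1]. Here [l] counts the factors
    [-Y] and [-X] taken from the expansions of [1 - Y] and [1 - X]. *)
Definition bailey_term (al be : C) (i j l : nat) : C :=
  (-(1)) ^ l * poch al (i + j - l) * poch be (i + j - l)
  * poch (al + be + INR (i + j - l)) l / (cfact l * cfact (i - l) * cfact (j - l)).

Lemma bailey_sum al be i j :
  csum (bailey_term al be i j) (S (Nat.min i j))
  = poch al i * poch be i * (poch al j * poch be j) / (cfact i * cfact j).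
Proof.
  assert (W : forall i j, (j <= i)%nat -> csum (bailey_term al be i j) (S j)
    = poch al i * poch be i * (poch al j * poch be j) / (cfact i * cfact j)).
  { clear i j; intros i j H.
    (* For [j <= i], factoring out the symbols of length [i] leaves Saalschutz's sum with parameters
       shifted by [i] and [x = i]; subtracting [x] undoes the shift. The case [i <= j] follows by
       symmetry. *)
    transitivity (poch al i * poch be i / cfact i
      * antidiag (saalschutz_term (al + INR i) (be + INR i) (INR i)) j).
    - unfold antidiag; rewrite <- csum_scal; apply csum_ext; intros l Hl.
      unfold bailey_term, saalschutz_term.
      replace (i + j - l)%nat with (i + (j - l))%nat by lia.
      rewrite !poch_add, poch_opp_INR, RtoC_INR_plus by lia.
      replace (al + INR i + (be + INR i) - INR i + INR (j - l))
        with (al + be + (INR i + INR (j - l))) by ring.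
      field; nz.
    - rewrite saalschutz.
      replace (al + INR i - INR i) with al by ring.
      replace (be + INR i - INR i) with be by ring.
      field; nz. }
  destruct (Nat.le_ge_cases j i) as [H|H].
  - rewrite Nat.min_r by assumption; apply W, H.
  - rewrite Nat.min_l by assumption.
    transitivity (csum (bailey_term al be j i) (S i)).
    + apply csum_ext; intros l Hl; unfold bailey_term; rewrite (Nat.add_comm i j); field; nz.
    + rewrite W by assumption; field; nz.
Qed.

(** * Absolutely summable families *)

(** Classical decidability lets [nodup] and the selection of a fibre work over an arbitrary index
    type. *)
Definition dec (P : Prop) : {P} + {~ P} := excluded_middle_informative P.
Definition eqdec {I : Type} (x y : I) : {x = y} + {x <> y} := dec (x = y).

Definition lsum {I : Type} (u : I -> C) (S : list I) : C :=
  fold_right (fun p acc => u p + acc) (RtoC 0) S.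

Definition rsum {I : Type} (w : I -> R) (S : list I) : R :=
  fold_right (fun p acc => w p + acc)%R 0%R S.

Definition bounded_sums {I : Type} (w : I -> R) : Prop :=
  exists M : R, forall S, NoDup S -> (rsum w S <= M)%R.

(* On [nat * nat] this unfolds to [is_double_series]. *)
Definition has_sum {I : Type} (u : I -> C) (l : C) : Prop :=
  forall eps : R, (0 < eps)%R ->
  exists S0 : list I, NoDup S0 /\
    forall S : list I, NoDup S -> incl S0 S -> (Cmod (lsum u S - l) < eps)%R.

(** The bound on finite sums of moduli accompanies the total because existence and regrouping rest
    on it, and every regrouped family inherits it. *)
Definition asum {I : Type} (u : I -> C) (l : C) : Prop :=
  bounded_sums (fun i => Cmod (u i)) /\ has_sum u l.

Section FiniteSums.
Context {I : Type}.
Implicit Types (u v : I -> C) (w : I -> R) (S T : list I).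

Lemma lsum_app u S T : lsum u (S ++ T) = lsum u S + lsum u T.
Proof. induction S as [|x S IH]; simpl; [ring | rewrite IH; ring]. Qed.

Lemma rsum_app w S T : (rsum w (S ++ T) = rsum w S + rsum w T)%R.
Proof. induction S as [|x S IH]; simpl; [ring | rewrite IH; ring]. Qed.

Lemma lsum_perm u S T : Permutation S T -> lsum u S = lsum u T.
Proof. induction 1; simpl; [reflexivity | congruence | ring | congruence]. Qed.

Lemma rsum_perm w S T : Permutation S T -> rsum w S = rsum w T.
Proof. induction 1; simpl; [reflexivity | congruence | ring | congruence]. Qed.

Lemma lsum_ext u v S : (forall i, In i S -> u i = v i) -> lsum u S = lsum v S.
Proof.
  induction S as [|x S IH]; simpl; intros H; [reflexivity|].
  rewrite IH, H by auto; reflexivity.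
Qed.

Lemma lsum_0 u S : (forall i, In i S -> u i = 0) -> lsum u S = 0.
Proof.
  induction S as [|x S IH]; simpl; intros H; [reflexivity|]. rewrite IH, H by auto; ring.
Qed.

Lemma lsum_scal c u S : lsum (fun i => c * u i) S = c * lsum u S.
Proof. induction S as [|x S IH]; simpl; [ring | rewrite IH; ring]. Qed.

Lemma rsum_scal c w S : (rsum (fun i => c * w i) S = c * rsum w S)%R.
Proof. induction S as [|x S IH]; simpl; [ring | rewrite IH; ring]. Qed.

Lemma rsum_le w w' S : (forall i, (w i <= w' i)%R) -> (rsum w S <= rsum w' S)%R.
Proof. intros H; induction S as [|x S IH]; simpl; [lra | specialize (H x); lra]. Qed.

Lemma rsum_ge0 w S : (forall i, (0 <= w i)%R) -> (0 <= rsum w S)%R.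
Proof. intros H; induction S as [|x S IH]; simpl; [lra | specialize (H x); lra]. Qed.

Lemma Cmod_lsum u S : (Cmod (lsum u S) <= rsum (fun i => Cmod (u i)) S)%R.
Proof.
  induction S as [|x S IH]; simpl; [rewrite Cmod_0; lra|].
  pose proof (Cmod_triangle (u x) (lsum u S)); lra.
Qed.

Lemma NoDup_incl_split S T :
  NoDup S -> incl S T -> exists R, Permutation T (S ++ R).
Proof.
  revert T; induction S as [|x S IH]; intros T N H.
  - exists T; reflexivity.
  - inversion_clear N as [|? ? Nx N'].
    destruct (in_split x T) as [T1 [T2 ->]]; [apply H; left; reflexivity|].
    destruct (IH (T1 ++ T2)) as [R HR]; [assumption| |].
    + intros y Hy; assert (Hy' := H y (or_intror Hy)).
      apply in_app_iff in Hy'; apply in_app_iff; simpl in Hy'.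
      destruct Hy' as [?|[<-|?]]; auto; contradiction.
    + exists R; simpl; rewrite <- HR; symmetry; apply Permutation_middle.
Qed.

Lemma rsum_incl w S T : (forall i, (0 <= w i)%R) ->
  NoDup S -> incl S T -> (rsum w S <= rsum w T)%R.
Proof.
  intros H N HI; destruct (NoDup_incl_split S T N HI) as [R HR].
  rewrite (rsum_perm _ _ _ HR), rsum_app; pose proof (rsum_ge0 w R H); lra.
Qed.

Lemma NoDup_append S T : NoDup S -> NoDup T -> (forall i, In i S -> ~ In i T) -> NoDup (S ++ T).
Proof.
  induction S as [|x S IH]; intros NS NT H; simpl; [assumption|].
  inversion_clear NS; constructor.
  - rewrite in_app_iff; intros [?|?]; [contradiction | exact (H x (or_introl eq_refl) H2)].
  - apply IH; auto; intros i Hi; apply H; right; assumption.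
Qed.

Lemma lsum_support u S T : NoDup S -> incl S T -> NoDup T ->
  (forall i, ~ In i S -> u i = 0) -> lsum u T = lsum u S.
Proof.
  intros NS HI NT H; destruct (NoDup_incl_split S T NS HI) as [R HR].
  rewrite (lsum_perm _ _ _ HR), lsum_app, (lsum_0 u R); [ring|].
  intros i Hi; apply H; intros Hi'.
  assert (N := Permutation_NoDup HR NT).
  destruct (in_split i R Hi) as [R1 [R2 ->]].
  rewrite app_assoc in N; apply NoDup_remove_2 in N; apply N; rewrite !in_app_iff; auto.
Qed.

Lemma has_sum_ext u v l : (forall i, u i = v i) -> has_sum u l -> has_sum v l.
Proof.
  intros E H eps He; destruct (H eps He) as [S0 [N HS]]; exists S0; split; [assumption|].
  intros S NS HI; rewrite <- (lsum_ext u v) by auto; auto.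
Qed.

Lemma has_sum_unique u l l' : has_sum u l -> has_sum u l' -> l = l'.
Proof.
  intros H H'; destruct (classic (l = l')) as [|ne]; [assumption|exfalso].
  assert (P : (0 < Cmod (l - l'))%R).
  { apply Cmod_gt_0; intros E; apply ne; replace l with (l - l' + l') by ring; rewrite E; ring. }
  destruct (H (Cmod (l - l') / 2)%R) as [S [N HS]]; [lra|].
  destruct (H' (Cmod (l - l') / 2)%R) as [S' [N' HS']]; [lra|].
  set (T := nodup eqdec (S ++ S')).
  assert (NT : NoDup T) by apply NoDup_nodup.
  assert (I1 : incl S T) by (intros i Hi; apply nodup_In, in_app_iff; auto).
  assert (I2 : incl S' T) by (intros i Hi; apply nodup_In, in_app_iff; auto).
  specialize (HS T NT I1); specialize (HS' T NT I2).
  pose proof (Cmod_triangle (- (lsum u T - l)) (lsum u T - l')) as Tr; rewrite Cmod_opp in Tr.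
  replace (- (lsum u T - l) + (lsum u T - l')) with (l - l') in Tr by ring; lra.
Qed.

Lemma has_sum_finite u S : NoDup S -> (forall i, ~ In i S -> u i = 0) ->
  has_sum u (lsum u S).
Proof.
  intros N H eps He; exists S; split; [assumption|]; intros T NT HI.
  rewrite (lsum_support u S T) by assumption.
  unfold Cminus; rewrite Cplus_opp_r, Cmod_0; assumption.
Qed.

Lemma has_sum_scal c u l : has_sum u l -> has_sum (fun i => c * u i) (c * l).
Proof.
  intros H eps He; pose proof (Cmod_ge_0 c).
  destruct (H (eps / (Cmod c + 1))%R) as [S0 [N HS]]; [apply Rdiv_lt_0_compat; lra|].
  exists S0; split; [assumption|]; intros S NS HI; specialize (HS S NS HI).
  rewrite lsum_scal; replace (c * lsum u S - c * l) with (c * (lsum u S - l)) by ring.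
  rewrite Cmod_mult; pose proof (Cmod_ge_0 (lsum u S - l)).
  apply Rle_lt_trans with ((Cmod c + 1) * Cmod (lsum u S - l))%R; [nra|].
  apply Rlt_le_trans with ((Cmod c + 1) * (eps / (Cmod c + 1)))%R; [|right; field; lra].
  apply Rmult_lt_compat_l; lra.
Qed.

Lemma bounded_sums_le (w w' : I -> R) K : (0 <= K)%R -> (forall i, (w i <= K * w' i)%R) ->
  bounded_sums w' -> bounded_sums w.
Proof.
  intros HK H [M HM]; exists (K * M)%R; intros S N.
  apply Rle_trans with (rsum (fun i => K * w' i)%R S); [apply rsum_le, H|].
  rewrite rsum_scal; apply Rmult_le_compat_l; auto.
Qed.

Lemma asum_ext u v l : (forall i, u i = v i) -> asum u l -> asum v l.
Proof.
  intros E [B H]; split; [|apply (has_sum_ext u); assumption].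
  apply (bounded_sums_le _ (fun i => Cmod (u i)) 1); [lra | | assumption].
  intros i; rewrite E; lra.
Qed.

Lemma asum_scal c u l : asum u l -> asum (fun i => c * u i) (c * l).
Proof.
  intros [B H]; split; [|apply has_sum_scal; assumption].
  apply (bounded_sums_le _ (fun i => Cmod (u i)) (Cmod c)); [apply Cmod_ge_0 | | assumption].
  intros i; rewrite Cmod_mult; lra.
Qed.

(** Choose [S0] with sum within [eps] of the supremum of all finite sums: a disjoint list
    contributing [eps] or more would exceed that supremum. *)
Lemma bounded_sums_tail w eps : (forall i, (0 <= w i)%R) -> bounded_sums w -> (0 < eps)%R ->
  exists S0, NoDup S0 /\
    forall R, NoDup R -> (forall i, In i S0 -> ~ In i R) -> (rsum w R < eps)%R.
Proof.
  intros Hw [M HM] He.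
  destruct (completeness (fun x => exists S, NoDup S /\ x = rsum w S)) as [m [Hub Hlub]].
  - exists M; intros x [S [N ->]]; auto.
  - exists 0%R, nil; split; [constructor | reflexivity].
  - destruct (classic (exists S, NoDup S /\ (m - eps < rsum w S)%R)) as [[S [N HS]]|no].
    + exists S; split; [assumption|]; intros R NR HR.
      assert (Hm := Hub (rsum w (S ++ R)) (ex_intro _ (S ++ R)
        (conj (NoDup_append S R N NR HR) eq_refl))).
      rewrite rsum_app in Hm; lra.
    + exfalso; assert (m <= m - eps)%R; [|lra].
      apply Hlub; intros x [S [N ->]]; apply Rnot_lt_le; intros ?; apply no; eauto.
Qed.

Lemma asum_exists u : bounded_sums (fun i => Cmod (u i)) -> exists l, asum u l.
Proof.
  intros B.
  (* The net of finite sums, as a filter: [P] belongs to it when it holds for all finite sums beyond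
     some [S0]. The tail estimate makes it Cauchy, and completeness of [C] gives the total. *)
  set (F := fun P : C -> Prop => exists S0, NoDup S0 /\
    forall S, NoDup S -> incl S0 S -> P (lsum u S)).
  assert (FF : ProperFilter F).
  { split.
    - intros P [S0 [N H]]; exists (lsum u S0); apply H; [assumption | apply incl_refl].
    - split.
      + exists nil; split; [constructor | auto].
      + intros P Q [S [N H]] [S' [N' H']]; exists (nodup eqdec (S ++ S')).
        split; [apply NoDup_nodup|]; intros T NT HI; split; [apply H | apply H'];
          try assumption; intros i Hi; apply HI, nodup_In, in_app_iff; auto.
      + intros P Q PQ [S [N H]]; exists S; split; auto. }
  assert (CF : @cauchy C_UniformSpace F).
  { intros [eps He].
    destruct (bounded_sums_tail (fun i => Cmod (u i)) eps) as [S0 [N H]];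
      [intros; apply Cmod_ge_0 | assumption | assumption |].
    exists (lsum u S0), S0; split; [assumption|]; intros S NS HI.
    apply C_NormedModule_mixin_compat1; simpl.
    destruct (NoDup_incl_split S0 S N HI) as [R HR].
    rewrite (lsum_perm _ _ _ HR), lsum_app.
    unfold minus, plus, opp; simpl.
    replace (lsum u S0 + lsum u R + - lsum u S0) with (lsum u R) by ring.
    apply Rle_lt_trans with (1 := Cmod_lsum u R).
    assert (ND := Permutation_NoDup HR NS).
    apply H; [apply (NoDup_app_remove_l S0), ND|].
    intros i Hi Hi'; destruct (in_split i R Hi') as [R1 [R2 ->]].
    rewrite app_assoc in ND; apply NoDup_remove_2 in ND; apply ND; rewrite !in_app_iff; auto. }
  exists (lim (F : (C_CompleteNormedModule -> Prop) -> Prop)); split; [assumption|].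
  intros eps He.
  (* Balls of [C] are taken coordinatewise, which costs a factor [sqrt 2] in the modulus; since
     [sqrt 2 < 2], the radius [eps / 2] suffices. *)
  assert (H2 : (0 < eps / 2)%R) by lra.
  destruct (complete_cauchy (T := C_CompleteNormedModule) F FF CF (mkposreal _ H2)) as [S0 [N H]].
  exists S0; split; [assumption|]; intros S NS HI; specialize (H S NS HI).
  apply C_NormedModule_mixin_compat2 in H; simpl in H.
  assert (sqrt 2 < 2)%R.
  { rewrite <- (sqrt_square 2) at 2 by lra; apply sqrt_lt_1; lra. }
  apply Rlt_trans with (1 := H); nra.
Qed.

End FiniteSums.

(** * Regrouping and reindexing of summable families *)

Lemma lsum_map {I J} (h : J -> I) (u : I -> C) S :
  lsum u (map h S) = lsum (fun j => u (h j)) S.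
Proof. induction S as [|x S IH]; simpl; [reflexivity | rewrite IH; reflexivity]. Qed.

Lemma lsum_filter {I} (P : I -> Prop) (u : I -> C) S :
  lsum (fun i => if dec (P i) then u i else 0) S
  = lsum u (filter (fun i => if dec (P i) then true else false) S).
Proof.
  induction S as [|x S IH]; simpl; [reflexivity|].
  destruct (dec (P x)); simpl; rewrite IH; ring.
Qed.

(** The source of all rearrangements below: partial sums by antidiagonals, bijective reindexing and
    iterated summation are choices of [f]. A fibre sum is written as a sum over all of [I], extended
    by zero. *)
Lemma asum_fiber {I J} (f : I -> J) (u : I -> C) (g : J -> C) l :
  asum u l ->
  (forall j, has_sum (fun i => if dec (f i = j) then u i else 0) (g j)) ->
  asum g l.
Proof.
  intros [[M HM] H] Hg.
  (* Over a finite [T] the fibre totals are approximated all at once by one finite [S] lying over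
     [T]. Containing the part of [S0] over [T] gives the limit; the comparison of moduli gives the
     bound for [g]. *)
  assert (K : forall (S0 : list I) (T : list J), NoDup T -> forall eps, (0 < eps)%R ->
    exists S, NoDup S /\ (forall i, In i S -> In (f i) T) /\
      (forall i, In i S0 -> In (f i) T -> In i S) /\
      (Cmod (lsum u S - lsum g T) < eps)%R /\
      (rsum (fun j => Cmod (g j)) T <= rsum (fun i => Cmod (u i)) S + eps)%R).
  { intros S0 T; induction T as [|j T IH]; intros NT eps He.
    - exists nil; simpl; repeat split; auto; try constructor.
      + unfold Cminus; rewrite Cplus_opp_r, Cmod_0; assumption.
      + lra.
    - inversion_clear NT as [|? ? Nj NT'].
      destruct (IH NT' (eps / 2)%R) as [S1 [N1 [A1 [B1 [C1 D1]]]]]; [lra|].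
      destruct (Hg j (eps / 2)%R) as [S2 [N2 H2]]; [lra|].
      (* [S2] controls the fibre of [j], and [S0] is added so that its points over [j] are kept.
         [S4] retains only the fibre, hence is disjoint from [S1], since [j] is not in [T]. *)
      set (S3 := nodup eqdec (S0 ++ S2)).
      specialize (H2 S3 (NoDup_nodup _ _)).
      rewrite lsum_filter in H2.
      set (S4 := filter (fun i => if dec (f i = j) then true else false) S3) in H2.
      assert (I4 : forall i, In i S4 <-> In i S3 /\ f i = j).
      { intros i; unfold S4; rewrite filter_In; destruct (dec (f i = j)); intuition congruence. }
      assert (E4 : (Cmod (lsum u S4 - g j) < eps / 2)%R).
      { apply H2; intros i Hi; apply nodup_In, in_app_iff; auto. }
      exists (S4 ++ S1); repeat split.
      + apply NoDup_append; [apply NoDup_filter, NoDup_nodup | assumption |].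
        intros i Hi Hi'; apply I4 in Hi; destruct Hi as [_ <-]; apply Nj, A1, Hi'.
      + intros i Hi; apply in_app_iff in Hi; destruct Hi as [Hi|Hi].
        * apply I4 in Hi; left; symmetry; apply Hi.
        * right; apply A1, Hi.
      + intros i Hi [Hj|Hj]; apply in_app_iff; [left | right; auto].
        apply I4; split; [apply nodup_In, in_app_iff; auto | auto].
      + rewrite lsum_app; simpl.
        replace (lsum u S4 + lsum u S1 - (g j + lsum g T))
          with ((lsum u S4 - g j) + (lsum u S1 - lsum g T)) by ring.
        eapply Rle_lt_trans; [apply Cmod_triangle | lra].
      + rewrite rsum_app; simpl.
        pose proof (Cmod_lsum u S4).
        pose proof (Cmod_triangle (lsum u S4) (- (lsum u S4 - g j))) as Tr; rewrite Cmod_opp in Tr.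
        replace (lsum u S4 + - (lsum u S4 - g j)) with (g j) in Tr by ring; lra. }
  split.
  - exists (M + 1)%R; intros T NT.
    destruct (K nil T NT 1%R Rlt_0_1) as [S [N [_ [_ [_ D]]]]]; specialize (HM S N); lra.
  - intros eps He; destruct (H (eps / 2)%R) as [S0 [N0 H0]]; [lra|].
    exists (nodup eqdec (map f S0)); split; [apply NoDup_nodup|]; intros T NT HI.
    destruct (K S0 T NT (eps / 2)%R) as [S [N [_ [B [D _]]]]]; [lra|].
    assert (IS : incl S0 S) by (intros i Hi; apply B, HI, nodup_In, in_map; assumption).
    specialize (H0 S N IS).
    replace (lsum g T - l) with (- (lsum u S - lsum g T) + (lsum u S - l)) by ring.
    eapply Rle_lt_trans; [apply Cmod_triangle | rewrite Cmod_opp; lra].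
Qed.

Lemma asum_finite_fiber {I J} (f : I -> J) (S : J -> list I) (u : I -> C) l :
  (forall j, NoDup (S j)) -> (forall i j, In i (S j) <-> f i = j) ->
  asum u l -> asum (fun j => lsum u (S j)) l.
Proof.
  intros N HS H; apply (asum_fiber f u); [assumption|]; intros j.
  rewrite <- (lsum_ext (fun i => if dec (f i = j) then u i else 0)).
  - apply has_sum_finite; [apply N|]; intros i Hi.
    destruct (dec (f i = j)) as [E|]; [exfalso; apply Hi, HS, E | reflexivity].
  - intros i Hi; apply HS in Hi; destruct (dec (f i = j)); [reflexivity | contradiction].
Qed.

Lemma asum_reindex {I J} (h : J -> I) (k : I -> J) (u : I -> C) l :
  (forall i, h (k i) = i) -> (forall j, k (h j) = j) ->
  asum u l -> asum (fun j => u (h j)) l.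
Proof.
  intros hk kh H.
  apply (asum_ext (fun j => lsum u (h j :: nil))); [intros j; simpl; ring|].
  apply (asum_finite_fiber k); [| | assumption].
  - intros j; repeat constructor; simpl; tauto.
  - intros i j; simpl; split.
    + intros [<-|[]]; apply kh.
    + intros <-; left; apply hk.
Qed.

Lemma asum_fst {I J} (u : I * J -> C) (g : I -> C) l :
  asum u l -> (forall i, has_sum (fun j => u (i, j)) (g i)) -> asum g l.
Proof.
  intros H Hg; apply (asum_fiber fst u); [assumption|]; intros i eps He.
  destruct (Hg i eps He) as [S0 [N0 H0]].
  exists (map (pair i) S0); split.
  - apply FinFun.Injective_map_NoDup; [intros ? ? E; congruence | assumption].
  - intros S NS HI; rewrite (lsum_filter (fun p => fst p = i)).
    set (S' := filter _ S).
    assert (I' : forall p, In p S' <-> In p S /\ fst p = i).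
    { intros p; unfold S'; rewrite filter_In; destruct (dec (fst p = i)); intuition congruence. }
    assert (E : S' = map (pair i) (map snd S')).
    { rewrite map_map; rewrite <- (map_id S') at 1; apply map_ext_in; intros [x y] Hp.
      apply I' in Hp; simpl in *; destruct Hp as [_ ->]; reflexivity. }
    rewrite E, lsum_map; apply H0.
    + apply (NoDup_map_inv (pair i)); rewrite <- E; apply NoDup_filter, NS.
    + intros j Hj; apply in_map_iff; exists (i, j); split; [reflexivity|].
      apply I'; split; [apply HI, in_map, Hj | reflexivity].
Qed.

Lemma lsum_seq f n : lsum f (seq 0 n) = csum f n.
Proof.
  induction n as [|n IH]; [reflexivity|].
  rewrite seq_S, lsum_app, IH; simpl; ring.
Qed.

(** The index in [K] is carried along unchanged, so that one pair of coordinates of a larger family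
    can be collapsed at a time. *)
Lemma asum_antidiag {K} (u : (nat * nat) * K -> C) l : asum u l ->
  asum (fun p : nat * K => antidiag (fun n d => u ((n, d), snd p)) (fst p)) l.
Proof.
  intros H.
  set (S := fun p : nat * K =>
    map (fun n => ((n, fst p - n)%nat, snd p)) (seq 0 (Datatypes.S (fst p)))).
  apply (asum_ext (fun p => lsum u (S p))).
  - intros p; unfold S, antidiag; rewrite lsum_map; apply lsum_seq.
  - apply (asum_finite_fiber (fun q => (fst (fst q) + snd (fst q), snd q)%nat)); [| | assumption].
    + intros p; apply FinFun.Injective_map_NoDup; [intros ? ? E; congruence | apply seq_NoDup].
    + intros [[n d] k] [N k']; unfold S; rewrite in_map_iff; simpl fst; simpl snd; split.
      * intros [x [E Hx]]; apply in_seq in Hx; injection E; intros; subst; f_equal; lia.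
      * intros E; injection E; intros <- <-; exists n; split; [f_equal; f_equal; lia|].
        apply in_seq; lia.
Qed.

Lemma asum_is_series (u : nat -> C) l : asum u l -> is_series u l.
Proof.
  intros [_ H]; intros P [eps HP].
  destruct (H eps) as [S0 [N0 H0]]; [apply cond_pos|].
  assert (B : exists L, forall i, In i S0 -> (i < L)%nat).
  { clear; induction S0 as [|x S [L HL]]; [exists O; simpl; tauto|].
    exists (Datatypes.S x + L)%nat; intros i [<-|Hi]; [lia | specialize (HL i Hi); lia]. }
  destruct B as [L HL]; exists L; intros n Hn; apply HP.
  apply C_NormedModule_mixin_compat1.
  assert (E : sum_n u n = lsum u (seq 0 (S n))).
  { clear; rewrite lsum_seq; induction n as [|n IH].
    - rewrite sum_O; simpl; ring.
    - rewrite sum_Sn, IH; reflexivity. }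
  change (Cmod (sum_n u n - l) < eps)%R; rewrite E.
  apply H0; [apply seq_NoDup|]; intros i Hi; apply in_seq; specialize (HL i Hi); lia.
Qed.

Lemma rsum_list_prod {I J} (u : I -> R) (v : J -> R) S T :
  (rsum (fun p => u (fst p) * v (snd p)) (list_prod S T) = rsum u S * rsum v T)%R.
Proof.
  induction S as [|x S IH]; simpl; [ring|].
  rewrite rsum_app, IH, Rmult_plus_distr_r; f_equal.
  clear; induction T as [|y T IH]; simpl; [ring | rewrite IH; ring].
Qed.

Lemma bounded_sums_prod {I J} (u : I -> R) (v : J -> R) :
  (forall i, (0 <= u i)%R) -> (forall j, (0 <= v j)%R) ->
  bounded_sums u -> bounded_sums v ->
  bounded_sums (fun p => (u (fst p) * v (snd p))%R).
Proof.
  intros Hu Hv [M HM] [M' HM']; exists (M * M')%R; intros S N.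
  set (A := nodup eqdec (map fst S)); set (B := nodup eqdec (map snd S)).
  apply Rle_trans with (rsum (fun p => u (fst p) * v (snd p))%R (list_prod A B)).
  - apply rsum_incl; [intros; apply Rmult_le_pos; auto | assumption |].
    intros [x y] H; apply in_prod; apply nodup_In, in_map_iff; exists (x, y); auto.
  - rewrite rsum_list_prod; apply Rmult_le_compat; try (apply rsum_ge0; assumption).
    + apply HM, NoDup_nodup.
    + apply HM', NoDup_nodup.
Qed.

Lemma bounded_sums_half_pow : bounded_sums (fun n => ((1 / 2) ^ n)%R).
Proof.
  exists 2%R; intros S N.
  assert (B : exists L, incl S (seq 0 L)).
  { clear; induction S as [|x S [L HL]]; [exists O; intros i []|].
    exists (Datatypes.S x + L)%nat; intros i [<-|Hi]; apply in_seq; [lia|].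
    specialize (HL i Hi); apply in_seq in HL; lia. }
  destruct B as [L HL].
  apply Rle_trans with (1 := rsum_incl (fun n => (1 / 2) ^ n)%R S (seq 0 L)
    (fun i => pow_le (1 / 2) i ltac:(lra)) N HL).
  assert (E : (rsum (fun n => (1 / 2) ^ n) (seq 0 L) = 2 - 2 * (1 / 2) ^ L)%R).
  { clear; induction L as [|L IH]; [simpl; lra|].
    rewrite seq_S, rsum_app, IH; simpl; lra. }
  rewrite E; pose proof (pow_le (1 / 2) L ltac:(lra)); lra.
Qed.

(** Domination first yields some total [m]; summing over the second index for each fixed first one
    then identifies [m] as the product. *)
Lemma asum_prod {I J} (u : I -> C) (v : J -> C) l l' : asum u l -> asum v l' ->
  asum (fun p => u (fst p) * v (snd p)) (l * l').
Proof.
  intros [Bu Hu] [Bv Hv].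
  destruct (asum_exists (fun p => u (fst p) * v (snd p))) as [m Hm].
  - apply (bounded_sums_le _ (fun p => Cmod (u (fst p)) * Cmod (v (snd p)))%R 1); [lra| |].
    + intros p; rewrite Cmod_mult; lra.
    + apply (bounded_sums_prod (fun i => Cmod (u i)) (fun j => Cmod (v j)));
        auto using Cmod_ge_0.
  - replace (l * l') with m; [assumption|].
    assert (H : asum (fun i => l' * u i) m).
    { apply (asum_fst _ _ _ Hm); intros i; simpl.
      rewrite Cmult_comm; apply has_sum_scal, Hv. }
    rewrite Cmult_comm; apply (has_sum_unique _ _ _ (proj2 H)), has_sum_scal, Hu.
Qed.

(** * Geometric bounds *)

Lemma Cmod_INR n : Cmod (INR n) = INR n.
Proof. rewrite Cmod_R; apply Rabs_pos_eq, pos_INR. Qed.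

Lemma Cmod_cfact n : Cmod (cfact n) = INR (fact n).
Proof. apply Cmod_INR. Qed.

Lemma INR_fact_pos n : (0 < INR (fact n))%R.
Proof. apply lt_0_INR, lt_O_fact. Qed.

Lemma Cmod_poch_le c (M j : nat) : (Cmod c <= INR M)%R ->
  (Cmod (poch c j) <= INR (fact j) * 2 ^ (M + j))%R.
Proof.
  intros Hc.
  (* [rf M j] is the rising factorial of [M], and [rf M j / j!] a binomial coefficient. *)
  set (rf := fix rf (M j : nat) : R :=
    match j with O => 1%R | S k => (rf M k * (INR M + INR k))%R end).
  assert (rf_shift : forall M j, (INR M * rf (S M) j = rf M j * (INR M + INR j))%R).
  { clear; intros M; induction j as [|j IH]; [simpl; ring|].
    change (rf (S M) (S j)) with (rf (S M) j * (INR (S M) + INR j))%R.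
    change (rf M (S j)) with (rf M j * (INR M + INR j))%R.
    rewrite <- Rmult_assoc, IH, !S_INR; ring. }
  assert (rf_ge0 : forall M j, (0 <= rf M j)%R).
  { clear; intros M; induction j as [|j IH]; simpl; [lra|].
    apply Rmult_le_pos; [assumption|]; pose proof (pos_INR M); pose proof (pos_INR j); lra. }
  assert (rf_le : forall M j, (rf M j <= INR (fact j) * 2 ^ (M + j))%R).
  { clear - rf_shift; induction M as [|M IHM]; induction j as [|j IHj].
    - simpl; lra.
    - change (rf O (S j)) with (rf O j * (INR 0 + INR j))%R.
      assert (Z : (INR 0 * rf 1%nat j = rf O j * (INR 0 + INR j))%R) by apply rf_shift.
      rewrite <- Z; simpl (INR 0); rewrite Rmult_0_l.
      apply Rmult_le_pos; [apply pos_INR | apply pow_le; lra].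
    - simpl (rf _ _); simpl (fact 0); simpl (INR 1); rewrite Rmult_1_l.
      apply pow_R1_Rle; lra.
    - assert (E : (rf (S M) (S j) = rf M (S j) + INR (S j) * rf (S M) j)%R).
      { change (rf (S M) (S j)) with (rf (S M) j * (INR (S M) + INR j))%R.
        change (rf M (S j)) with (rf M j * (INR M + INR j))%R.
        rewrite <- (rf_shift M j), !S_INR; ring. }
      rewrite E; specialize (IHM (S j)).
      apply Rle_trans with (INR (fact (S j)) * 2 ^ (M + S j)
        + INR (S j) * (INR (fact j) * 2 ^ (S M + j)))%R.
      + apply Rplus_le_compat; [assumption|].
        apply Rmult_le_compat_l; [apply pos_INR | assumption].
      + right; rewrite fact_simpl, mult_INR.
        replace (M + S j)%nat with (S (M + j)) by lia.
        replace (S M + S j)%nat with (S (S (M + j))) by lia.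
        replace (S M + j)%nat with (S (M + j)) by lia.
        simpl pow; ring. }
  apply Rle_trans with (rf M j); [|apply rf_le].
  clear - Hc rf_ge0; induction j as [|j IH].
  - simpl; rewrite Cmod_1; lra.
  - rewrite poch_S, Cmod_mult.
    change (rf M (S j)) with (rf M j * (INR M + INR j))%R.
    apply Rmult_le_compat; try apply Cmod_ge_0; [assumption|].
    eapply Rle_trans; [apply Cmod_triangle|]; rewrite Cmod_INR; lra.
Qed.

Lemma nat_upper_bound (r : R) : exists M : nat, (r <= INR M)%R.
Proof.
  destruct (INR_unbounded r) as [n Hn]; exists n; lra.
Qed.

(** For [k >= L], [Cmod (d + INR k)] is at least [k - Cmod d], hence at least [(k + 1)/4]. The
    finitely many smaller [k] contribute a positive minimum because [d + k] never vanishes. *)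
Lemma Cmod_add_INR_ge d : not_nonpos_int d ->
  exists e, (0 < e)%R /\ forall k, (e * (INR k + 1) <= Cmod (d + INR k))%R.
Proof.
  intros hd; destruct (nat_upper_bound (2 * Cmod d + 1)) as [L HL].
  assert (F : forall n, exists e, (0 < e)%R /\
    forall k, (k < n)%nat -> (e * (INR k + 1) <= Cmod (d + INR k))%R).
  { induction n as [|n [e [He H]]]; [exists 1%R; split; [lra | lia]|].
    assert (P := proj1 (Cmod_gt_0 _) (not_nonpos_int_add_neq0 d n hd)).
    pose proof (pos_INR n).
    assert (P' : (0 < Cmod (d + INR n) / (INR n + 1))%R) by (apply Rdiv_lt_0_compat; lra).
    exists (Rmin e (Cmod (d + INR n) / (INR n + 1))); split; [apply Rmin_glb_lt; assumption|].
    intros k Hk; pose proof (pos_INR k).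
    destruct (Nat.eq_dec k n) as [->|ne].
    - apply Rle_trans with (Cmod (d + INR n) / (INR n + 1) * (INR n + 1))%R;
        [|right; field; lra].
      apply Rmult_le_compat_r; [lra | apply Rmin_r].
    - apply Rle_trans with (e * (INR k + 1))%R; [|apply H; lia].
      apply Rmult_le_compat_r; [lra | apply Rmin_l]. }
  destruct (F L) as [e [He H]].
  exists (Rmin e (1 / 4)); split; [apply Rmin_glb_lt; lra|]; intros k; pose proof (pos_INR k).
  destruct (Nat.lt_ge_cases k L) as [Hk|Hk].
  - apply Rle_trans with (e * (INR k + 1))%R; [|apply H, Hk].
    apply Rmult_le_compat_r; [lra | apply Rmin_l].
  - apply le_INR in Hk.
    apply Rle_trans with (1 / 4 * (INR k + 1))%R.
    + apply Rmult_le_compat_r; [lra | apply Rmin_r].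
    + pose proof (Cmod_triangle (d + INR k) (- d)) as T; rewrite Cmod_opp in T.
      replace (d + INR k + - d) with (RtoC (INR k)) in T by ring; rewrite Cmod_INR in T.
      pose proof (Cmod_ge_0 d); lra.
Qed.

(** Each factor [(b + k)/(d + k)] is bounded uniformly in [k]. The geometric bound is far from the
    true polynomial growth, but it is enough for some positive radius. *)
Lemma Cmod_poch_ratio b d : not_nonpos_int d ->
  exists K, (1 <= K)%R /\ forall n, (Cmod (poch b n / poch d n) <= K ^ n)%R.
Proof.
  intros hd; destruct (Cmod_add_INR_ge d hd) as [e [He H]].
  set (K := Rmax 1 ((Cmod b + 1) / e)).
  exists K; split; [apply Rmax_l|].
  assert (KB : forall k, (Cmod (b + INR k) <= K * Cmod (d + INR k))%R).
  { intros k; pose proof (pos_INR k); pose proof (Cmod_ge_0 b).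
    apply Rle_trans with ((Cmod b + 1) * (INR k + 1))%R.
    - eapply Rle_trans; [apply Cmod_triangle|]; rewrite Cmod_INR; nra.
    - apply Rle_trans with ((Cmod b + 1) / e * (e * (INR k + 1)))%R; [right; field; lra|].
      apply Rmult_le_compat; [apply Rdiv_le_0_compat; lra | nra | apply Rmax_r | apply H]. }
  induction n as [|n IH].
  - simpl; replace (1 / 1) with (RtoC 1) by field; rewrite Cmod_1; lra.
  - rewrite !poch_S; simpl pow.
    replace (poch b n * (b + INR n) / (poch d n * (d + INR n)))
      with ((b + INR n) / (d + INR n) * (poch b n / poch d n)) by (field; nz).
    rewrite Cmod_mult; apply Rmult_le_compat; try apply Cmod_ge_0; [|assumption].
    assert (P := proj1 (Cmod_gt_0 _) (not_nonpos_int_add_neq0 d n hd)).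
    rewrite Cmod_div by nz; apply Rle_div_l; [assumption | apply KB].
Qed.

Lemma Cmod_poch_div_cfact c (M j : nat) : (Cmod c <= INR M)%R ->
  (Cmod (poch c j / cfact j) <= 2 ^ (M + j))%R.
Proof.
  intros H; rewrite Cmod_div, Cmod_cfact by nz.
  apply Rle_div_l; [apply INR_fact_pos|]; rewrite Rmult_comm; apply Cmod_poch_le, H.
Qed.

Lemma Cmod_binomial p i : (Cmod (cfact (p + i) / (cfact p * cfact i)) <= 2 ^ (p + i + 1))%R.
Proof.
  replace (cfact (p + i) / (cfact p * cfact i)) with (poch (1 + INR p) i / cfact i).
  - replace (p + i + 1)%nat with (S p + i)%nat by lia.
    apply Cmod_poch_div_cfact; rewrite Cplus_comm, <- RtoC_INR_S, Cmod_INR; lra.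
  - rewrite <- !poch_1, poch_add; field; rewrite !poch_1; nz.
Qed.

(** * Exponential, logarithm and the binomial series *)

Lemma Cexp_plus z w : Cexp (z + w) = Cexp z * Cexp w.
Proof.
  destruct z as [x y], w as [x' y']; unfold Cexp, Cmult; simpl.
  rewrite exp_plus, cos_plus, sin_plus; f_equal; ring.
Qed.

Lemma Cexp_0 : Cexp 0 = 1.
Proof.
  unfold Cexp; simpl; rewrite exp_0, cos_0, sin_0, Rmult_1_l, Rmult_0_r; reflexivity.
Qed.

Lemma Cexp_neq0 z : Cexp z <> 0.
Proof.
  intros H; apply (RtoC_neq 1 0); [lra|].
  rewrite <- Cexp_0, <- (Cplus_opp_r z), Cexp_plus, H; ring.
Qed.

Lemma Cexp_INR_mult n z : Cexp (INR n * z) = Cexp z ^ n.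
Proof.
  induction n as [|n IH].
  - simpl; rewrite Cmult_0_l, Cexp_0; reflexivity.
  - rewrite RtoC_INR_S, Cpow_S, <- IH, <- Cexp_plus; f_equal; ring.
Qed.

Lemma Cmod_Cexp z : Cmod (Cexp z) = exp (Re z).
Proof.
  unfold Cexp, Cmod; simpl.
  replace (exp (Re z) * cos (Im z) * (exp (Re z) * cos (Im z) * 1)
    + exp (Re z) * sin (Im z) * (exp (Re z) * sin (Im z) * 1))%R
    with ((exp (Re z))² * ((sin (Im z))² + (cos (Im z))²))%R by (unfold Rsqr; ring).
  rewrite sin2_cos2, Rmult_1_r; apply sqrt_Rsqr; left; apply exp_pos.
Qed.

Lemma Clog_Cexp w : (- (PI / 2) < Im w < PI / 2)%R -> Clog (Cexp w) = w.
Proof.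
  intros H; unfold Clog; rewrite Cmod_Cexp, ln_exp; unfold Carg.
  assert (P : (0 < cos (Im w))%R) by (apply cos_gt_0; lra).
  pose proof (exp_pos (Re w)) as E.
  unfold Cexp at 1; simpl Re; destruct (Rlt_dec _ _) as [_|n]; [|exfalso; apply n; nra].
  unfold Cexp; simpl.
  replace (exp (Re w) * sin (Im w) / (exp (Re w) * cos (Im w)))%R with (tan (Im w))
    by (unfold tan; field; lra).
  rewrite atan_tan by assumption; destruct w; reflexivity.
Qed.

Lemma Carg_Re_pos z : (0 < Re z)%R -> Carg z = atan (Im z / Re z).
Proof. intros H; unfold Carg; destruct (Rlt_dec _ _); [reflexivity | contradiction]. Qed.

Lemma Cexp_Clog z : (0 < Re z)%R -> Cexp (Clog z) = z.
Proof.
  intros H; unfold Clog; rewrite Carg_Re_pos by assumption.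
  unfold Cexp; simpl.
  assert (P : (0 < Cmod z)%R).
  { apply Cmod_gt_0; intros ->; simpl in H; lra. }
  rewrite exp_ln by assumption.
  assert (E : (sqrt (1 + (Im z / Re z)²) = Cmod z / Re z)%R).
  { apply sqrt_lem_1; [pose proof (Rle_0_sqr (Im z / Re z)); lra | apply Rdiv_le_0_compat; lra|].
    replace (Cmod z / Re z * (Cmod z / Re z))%R with (Cmod z ^ 2 / (Re z * Re z))%R
      by (field; lra).
    rewrite Cmod2_alt; unfold Rsqr; field; lra. }
  rewrite cos_atan, sin_atan, E; destruct z as [x y]; simpl in *.
  f_equal; field; split; lra.
Qed.

(** With radius 1/4 the real part exceeds 3/4 and the imaginary part is below 1/4 in absolute value,
    so the argument is below [PI / 4]. Two arguments then add up within the range where [Clog]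
    inverts [Cexp]. *)
Definition near1 (z : C) : Prop := (Cmod (z - 1) < 1 / 4)%R.

Lemma near1_Re z : near1 z -> (3 / 4 < Re z)%R.
Proof.
  unfold near1; intros H; pose proof (re_le_Cmod (z - 1)) as R.
  unfold Rabs in R; destruct z as [x y]; simpl in *; destruct (Rcase_abs _); lra.
Qed.

Lemma near1_Carg z : near1 z -> (- (PI / 4) < Im (Clog z) < PI / 4)%R.
Proof.
  intros H; pose proof (near1_Re z H) as R; simpl; rewrite Carg_Re_pos by lra.
  assert (I : (Rabs (Im z) < 1 / 4)%R).
  { apply Rle_lt_trans with (Cmod (z - 1)); [|assumption].
    destruct z as [x y]; unfold Cminus, Cplus, Copp; simpl.
    eapply Rle_trans; [|apply Rmax_Cmod]; simpl.
    replace (y + - 0)%R with y by ring; apply Rmax_r. }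
  apply Rabs_def2 in I.
  rewrite <- atan_1, <- atan_opp; split; apply atan_increasing.
  - apply Rlt_div_r; lra.
  - apply Rlt_div_l; lra.
Qed.

Lemma Clog_mult z w : near1 z -> near1 w -> Clog (z * w) = Clog z + Clog w.
Proof.
  intros Hz Hw; pose proof (near1_Carg z Hz); pose proof (near1_Carg w Hw).
  pose proof (near1_Re z Hz); pose proof (near1_Re w Hw).
  rewrite <- (Cexp_Clog z), <- (Cexp_Clog w) at 1 by lra.
  rewrite <- Cexp_plus; apply Clog_Cexp; simpl in *; lra.
Qed.

(** * The binomial series for the principal power, by a differential equation along a segment *)

Definition Cder (f : R -> C) (x : R) (l : C) : Prop :=
  is_derive (fun t => Re (f t)) x (Re l) /\ is_derive (fun t => Im (f t)) x (Im l).

Lemma Cder_mult f g x f' g' : Cder f x f' -> Cder g x g' ->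
  Cder (fun t => f t * g t) x (f' * g x + f x * g').
Proof.
  assert (H : forall (p q r s : R -> R) p' q' r' s',
    is_derive p x p' -> is_derive q x q' -> is_derive r x r' -> is_derive s x s' ->
    is_derive (fun t => p t * r t - q t * s t)%R x
      (p' * r x - q' * s x + (p x * r' - q x * s'))%R /\
    is_derive (fun t => p t * s t + q t * r t)%R x
      (p' * s x + q' * r x + (p x * s' + q x * r'))%R).
  { intros p q r s p' q' r' s' Hp Hq Hr Hs.
    split; auto_derive; try (repeat split; eexists; eassumption);
      rewrite (is_derive_unique (fun t : R => p t) _ _ Hp), (is_derive_unique (fun t : R => q t) _ _ Hq),
        (is_derive_unique (fun t : R => r t) _ _ Hr), (is_derive_unique (fun t : R => s t) _ _ Hs); ring. }
  intros [f1 f2] [g1 g2]; exact (H _ _ _ _ _ _ _ _ f1 f2 g1 g2).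
Qed.

Lemma Cder_scal c f x f' : Cder f x f' -> Cder (fun t => c * f t) x (c * f').
Proof.
  intros H.
  replace (c * f') with (0 * f x + c * f') by ring.
  apply (Cder_mult (fun _ => c)); [|assumption].
  split; apply @is_derive_const.
Qed.

Lemma Cder_exp f x f' : Cder f x f' -> Cder (fun t => Cexp (f t)) x (f' * Cexp (f x)).
Proof.
  assert (H : forall (p q : R -> R) p' q', is_derive p x p' -> is_derive q x q' ->
    is_derive (fun t => exp (p t) * cos (q t))%R x
      (p' * (exp (p x) * cos (q x)) - q' * (exp (p x) * sin (q x)))%R /\
    is_derive (fun t => exp (p t) * sin (q t))%R x
      (p' * (exp (p x) * sin (q x)) + q' * (exp (p x) * cos (q x)))%R).
  { intros p q p' q' Hp Hq.
    split; auto_derive; try (repeat split; eexists; eassumption);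
      rewrite (is_derive_unique (fun t : R => p t) _ _ Hp), (is_derive_unique (fun t : R => q t) _ _ Hq); ring. }
  intros [f1 f2]; exact (H _ _ _ _ f1 f2).
Qed.

Lemma Re_1_sub_pos (w : C) (t : R) : (Cmod (t * w) < 1)%R -> (0 < 1 - t * Re w)%R.
Proof.
  intros H; pose proof (re_le_Cmod (t * w)) as R; destruct w as [x y]; simpl in *.
  replace (t * x - 0 * y)%R with (t * x)%R in R by ring.
  unfold Rabs in R; destruct (Rcase_abs _) in R; lra.
Qed.

Lemma Cder_log (w : C) (x : R) : (Cmod (x * w) < 1)%R ->
  Cder (fun t : R => Clog (1 - t * w)) x (- w / (1 - x * w)).
Proof.
  intros H.
  assert (P := Re_1_sub_pos w x H).
  assert (L : locally x (fun t => (0 < 1 - t * Re w)%R)).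
  { apply (open_comp (fun t => (1 - t * Re w)%R) (fun y => (0 < y)%R)).
    - intros y _; apply (ex_derive_continuous (fun t : R => (1 - t * Re w)%R)); auto_derive; trivial.
    - apply open_gt.
    - assumption. }
  assert (Q : (0 < (1 - x * Re w) * (1 - x * Re w) + x * Im w * (x * Im w))%R) by nra.
  assert (E : - w / (1 - x * w)
    = (((- Re w * (1 - x * Re w) + x * Im w * Im w)
          / ((1 - x * Re w) * (1 - x * Re w) + x * Im w * (x * Im w)))%R,
       ((- Im w) / ((1 - x * Re w) * (1 - x * Re w) + x * Im w * (x * Im w)))%R)).
  { destruct w as [a b]; unfold Cdiv, Cinv, Cmult, Cminus, Copp, Cplus, RtoC; simpl in *.
    f_equal; field; nra. }
  rewrite E; split; simpl.
  (* [ln (Cmod z)] is replaced by half the logarithm of the squared modulus, which removes the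
     square root before differentiating. *)
  - apply (is_derive_ext_loc (fun t =>
      / 2 * ln ((1 - t * Re w) * (1 - t * Re w) + t * Im w * (t * Im w)))%R).
    + apply (filter_imp (fun t => (0 < 1 - t * Re w)%R)); [|assumption].
      intros t Ht; unfold Cmod.
      replace (fst (1 - t * w)%C ^ 2 + snd (1 - t * w)%C ^ 2)%R
        with ((1 - t * Re w) * (1 - t * Re w) + t * Im w * (t * Im w))%R
        by (destruct w; simpl; ring).
      rewrite <- Rpower_sqrt by nra; unfold Rpower; rewrite ln_exp; reflexivity.
    + auto_derive; [assumption | field; lra].
  - apply (is_derive_ext_loc (fun t => atan (- (t * Im w) / (1 - t * Re w)))%R).
    + apply (filter_imp (fun t => (0 < 1 - t * Re w)%R)); [|assumption].
      intros t Ht; rewrite Carg_Re_pos.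
      * f_equal; f_equal; destruct w; simpl; ring.
      * destruct w; simpl in *; lra.
    + auto_derive; [lra|]. unfold Rsqr; field; split; lra.
Qed.

Lemma is_series_Re (u : nat -> C) l : is_series u l -> is_series (fun n => Re (u n)) (Re l).
Proof.
  intros H P [eps HP].
  assert (L : locally (l : C_NormedModule) (fun y => P (Re y))).
  { exists eps; intros y [Hy _]; apply HP, Hy. }
  destruct (H _ L) as [N HN]; exists N; intros n Hn; specialize (HN n Hn).
  assert (E : sum_n (fun k => Re (u k)) n = Re (sum_n u n)).
  { clear; induction n as [|n IH]; [rewrite !sum_O; reflexivity|].
    rewrite !sum_Sn, IH; reflexivity. }
  change (P (sum_n (fun k => Re (u k)) n)); rewrite E; exact HN.
Qed.

Lemma is_series_Im (u : nat -> C) l : is_series u l -> is_series (fun n => Im (u n)) (Im l).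
Proof.
  intros H P [eps HP].
  assert (L : locally (l : C_NormedModule) (fun y => P (Im y))).
  { exists eps; intros y [_ Hy]; apply HP, Hy. }
  destruct (H _ L) as [N HN]; exists N; intros n Hn; specialize (HN n Hn).
  assert (E : sum_n (fun k => Im (u k)) n = Im (sum_n u n)).
  { clear; induction n as [|n IH]; [rewrite !sum_O; reflexivity|].
    rewrite !sum_Sn, IH; reflexivity. }
  change (P (sum_n (fun k => Im (u k)) n)); rewrite E; exact HN.
Qed.

Lemma Im_le_Cmod z : (Rabs (Im z) <= Cmod z)%R.
Proof. eapply Rle_trans; [apply Rmax_r | apply Rmax_Cmod]. Qed.

(** The ratio 1/4 gives radius at least 2, so the whole closed segment from 0 to 1, endpoint
    included, is interior to the disc of convergence. *)
Lemma CV_radius_gt_1 (a : nat -> R) K :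
  (forall n, (Rabs (a n) <= K * (1 / 4) ^ n)%R) ->
  forall x : R, (0 <= x <= 1)%R -> Rbar_lt (Rabs x) (CV_radius a).
Proof.
  intros H x Hx; apply Rbar_lt_le_trans with 2%R.
  - simpl; rewrite Rabs_pos_eq; lra.
  - apply (proj1 (CV_radius_bounded a)); exists K; intros n.
    rewrite Rabs_mult, <- RPow_abs, (Rabs_pos_eq 2) by lra.
    apply Rle_trans with (K * (1 / 4) ^ n * 2 ^ n)%R.
    + apply Rmult_le_compat_r; [apply pow_le; lra | apply H].
    + rewrite Rmult_assoc, <- Rpow_mult_distr.
      assert (0 <= K)%R by (specialize (H O); pose proof (Rabs_pos (a O)); simpl in H; lra).
      assert ((1 / 4 * 2) ^ n <= 1 ^ n)%R by (apply pow_incr; lra).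
      rewrite pow1 in *; nra.
Qed.

Lemma PSeries_comb (a b : nat -> R) (c d x : R) : ex_pseries a x -> ex_pseries b x ->
  ex_pseries (fun n => c * a n + d * b n)%R x /\
  PSeries (fun n => c * a n + d * b n)%R x = (c * PSeries a x + d * PSeries b x)%R.
Proof.
  intros Ha Hb.
  assert (H : is_pseries (PS_plus (PS_scal c a) (PS_scal d b)) x
    (plus (scal c (PSeries a x)) (scal d (PSeries b x)))).
  { apply (is_pseries_plus (V := R_NormedModule)); apply (is_pseries_scal (V := R_NormedModule));
      first [apply Rmult_comm | apply PSeries_correct; assumption]. }
  split; [eexists; exact H | apply is_pseries_unique, H].
Qed.

Lemma PSeries_INR_mult (a : nat -> R) (x : R) : ex_pseries (PS_derive a) x ->
  ex_pseries (fun n => INR n * a n)%R x /\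
  PSeries (fun n => INR n * a n)%R x = (x * PSeries (PS_derive a) x)%R.
Proof.
  intros H.
  assert (E : forall n, PS_incr_1 (PS_derive a) n = (INR n * a n)%R)
    by (intros [|n]; [simpl; unfold zero; simpl; ring | reflexivity]).
  split.
  - apply (ex_pseries_ext _ _ _ E), ex_pseries_incr_1, H.
  - rewrite <- (PSeries_ext _ _ x E); apply PSeries_incr_1.
Qed.

(** Along the segment from 0 to [w], the series times the principal power [(1 - x w)^c] has
    derivative zero and is 1 at the start; at [x = 1] the series is therefore the inverse power. The
    bound 1/8 on [w] beats the growth [2^j] of the coefficients with decay [(1/4)^j] to spare. *)
Lemma binomial_asum c w : (Cmod w <= 1 / 8)%R ->
  asum (fun j => poch c j / cfact j * w ^ j) (Cpower (1 - w) (- c)).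
Proof.
  intros Hw.
  set (e := fun j => poch c j / cfact j * w ^ j).
  destruct (nat_upper_bound (Cmod c)) as [M HM].
  assert (Be : forall j, (Cmod (e j) <= 2 ^ M * (1 / 4) ^ j)%R).
  { intros j; unfold e; rewrite Cmod_mult, Cmod_pow.
    apply Rle_trans with (2 ^ (M + j) * (1 / 8) ^ j)%R.
    - apply Rmult_le_compat; [apply Cmod_ge_0 | apply pow_le, Cmod_ge_0 | |].
      + apply Cmod_poch_div_cfact, HM.
      + apply pow_incr; split; [apply Cmod_ge_0 | assumption].
    - right; rewrite pow_add, Rmult_assoc, <- Rpow_mult_distr; do 2 f_equal; field. }
  assert (P2 : (0 < 2 ^ M)%R) by (apply pow_lt; lra).
  destruct (asum_exists e) as [l Hl].
  { apply (bounded_sums_le _ (fun n => (1 / 2) ^ n)%R (2 ^ M)); [lra | |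
      apply bounded_sums_half_pow].
    intros j; eapply Rle_trans; [apply Be|]; apply Rmult_le_compat_l; [lra|].
    apply pow_incr; lra. }
  replace (Cpower (1 - w) (- c)) with l; [assumption|].
  set (a := fun j => Re (e j)); set (b := fun j => Im (e j)).
  assert (Ra := CV_radius_gt_1 a _ (fun n => Rle_trans _ _ _ (re_le_Cmod (e n)) (Be n))).
  assert (Rb := CV_radius_gt_1 b _ (fun n => Rle_trans _ _ _ (Im_le_Cmod (e n)) (Be n))).
  assert (Xa : forall x, (0 <= x <= 1)%R -> ex_pseries a x)
    by (intros x Hx; apply CV_radius_inside, Ra, Hx).
  assert (Xb : forall x, (0 <= x <= 1)%R -> ex_pseries b x)
    by (intros x Hx; apply CV_radius_inside, Rb, Hx).
  assert (Xa' : forall x, (0 <= x <= 1)%R -> ex_pseries (PS_derive a) x)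
    by (intros x Hx; apply CV_radius_inside; rewrite CV_radius_derive; apply Ra, Hx).
  assert (Xb' : forall x, (0 <= x <= 1)%R -> ex_pseries (PS_derive b) x)
    by (intros x Hx; apply CV_radius_inside; rewrite CV_radius_derive; apply Rb, Hx).
  (* The complex series in the real variable [x] is handled as the pair of its real and imaginary
     power series. *)
  set (f := fun x => (PSeries a x, PSeries b x) : C).
  set (f' := fun x => (PSeries (PS_derive a) x, PSeries (PS_derive b) x) : C).
  assert (Df : forall x, (0 <= x <= 1)%R -> Cder f x (f' x)).
  { intros x Hx; split; apply is_derive_PSeries; auto. }
  (* [f] solves [(1 - x w) f' = c w f]. *)
  assert (rec : forall n, (INR n + 1) * e (S n) = c * w * e n + INR n * w * e n).
  { intros n; unfold e; rewrite poch_S, cfact_S, Cpow_S; field; nz. }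
  assert (ode : forall x : R, (0 <= x <= 1)%R -> f' x = c * w * f x + x * w * f' x).
  { intros x Hx; set (g := c * w) in *; clearbody g.
    destruct (PSeries_INR_mult a x (Xa' x Hx)) as [Xi Ei].
    destruct (PSeries_INR_mult b x (Xb' x Hx)) as [Xj Ej].
    assert (Ea : PSeries (PS_derive a) x = (Re g * PSeries a x - Im g * PSeries b x
      + x * (Re w * PSeries (PS_derive a) x - Im w * PSeries (PS_derive b) x))%R).
    { destruct (PSeries_comb a b (Re g) (- Im g) x (Xa x Hx) (Xb x Hx)) as [X1 E1].
      destruct (PSeries_comb _ _ (Re w) (- Im w) x Xi Xj) as [X2 E2].
      destruct (PSeries_comb _ _ 1 1 x X1 X2) as [_ E3].
      transitivity (1 * (Re g * PSeries a x + - Im g * PSeries b x) + 1 * (Re w *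
        (x * PSeries (PS_derive a) x) + - Im w * (x * PSeries (PS_derive b) x)))%R; [|ring].
      rewrite <- Ei, <- Ej, <- E1, <- E2, <- E3; apply PSeries_ext; intros n.
      unfold PS_derive, a, b; pose proof (f_equal Re (rec n)) as E.
      destruct (e n), (e (S n)), g, w; rewrite S_INR; simpl in *; lra. }
    assert (Eb : PSeries (PS_derive b) x = (Re g * PSeries b x + Im g * PSeries a x
      + x * (Re w * PSeries (PS_derive b) x + Im w * PSeries (PS_derive a) x))%R).
    { destruct (PSeries_comb b a (Re g) (Im g) x (Xb x Hx) (Xa x Hx)) as [X1 E1].
      destruct (PSeries_comb _ _ (Re w) (Im w) x Xj Xi) as [X2 E2].
      destruct (PSeries_comb _ _ 1 1 x X1 X2) as [_ E3].
      transitivity (1 * (Re g * PSeries b x + Im g * PSeries a x) + 1 * (Re w *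
        (x * PSeries (PS_derive b) x) + Im w * (x * PSeries (PS_derive a) x)))%R; [|ring].
      rewrite <- Ei, <- Ej, <- E1, <- E2, <- E3; apply PSeries_ext; intros n.
      unfold PS_derive, a, b; pose proof (f_equal Im (rec n)) as E.
      destruct (e n), (e (S n)), g, w; rewrite S_INR; simpl in *; lra. }
    apply injective_projections.
    - unfold f', f; simpl fst; rewrite Ea at 1; simpl; unfold Re, Im; ring.
    - unfold f', f; simpl snd; rewrite Eb at 1; simpl; unfold Re, Im; ring. }
  set (h := fun x : R => f x * Cexp (c * Clog (1 - x * w))).
  assert (Dh : forall x, (0 <= x <= 1)%R -> Cder h x 0).
  { intros x Hx.
    assert (Hxw : (Cmod (x * w) < 1)%R).
    { rewrite Cmod_mult, Cmod_R, Rabs_pos_eq by lra; pose proof (Cmod_ge_0 w); nra. }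
    assert (nz1 : 1 - x * w <> 0).
    { intros E; replace (x * w) with (1 - (1 - x * w)) in Hxw by ring.
      rewrite E in Hxw; replace (1 - 0) with (RtoC 1) in Hxw by ring; rewrite Cmod_1 in Hxw; lra. }
    replace (RtoC 0) with (f' x * Cexp (c * Clog (1 - x * w))
      + f x * (c * (- w / (1 - x * w)) * Cexp (c * Clog (1 - x * w)))).
    - apply (Cder_mult f (fun x : R => Cexp (c * Clog (1 - x * w)))); [apply Df, Hx|].
      apply (Cder_exp (fun x : R => c * Clog (1 - x * w))).
      apply (Cder_scal c (fun x : R => Clog (1 - x * w))), Cder_log, Hxw.
    - transitivity ((f' x - (c * w * f x + x * w * f' x)) / (1 - x * w)
        * Cexp (c * Clog (1 - x * w))); [field; assumption|].
      rewrite <- (ode x Hx); unfold Cminus at 1; rewrite Cplus_opp_r; unfold Cdiv; ring. }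
  assert (h01 : h 0%R = h 1%R).
  { apply injective_projections; [apply (eq_is_derive (fun x => Re (h x))) |
      apply (eq_is_derive (fun x => Im (h x)))]; try lra; intros x Hx; apply Dh, Hx. }
  assert (h0 : h 0%R = 1).
  { unfold h, f; rewrite !PSeries_0; unfold a, b.
    replace (1 - 0 * w) with (RtoC 1) by ring.
    replace (Cexp (c * Clog 1)) with (RtoC 1) by (symmetry; apply Cpower_1_l).
    assert (e0 : e O = 1) by (unfold e; rewrite cfact_0; simpl; field).
    rewrite e0, Cmult_1_r; reflexivity. }
  assert (f1 : l = f 1%R).
  { apply injective_projections.
    - symmetry; unfold f; simpl.
      transitivity (Series a); [apply Series_ext; intros n; rewrite pow1; ring|].
      apply is_series_unique, is_series_Re, asum_is_series, Hl.
    - symmetry; unfold f; simpl.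
      transitivity (Series b); [apply Series_ext; intros n; rewrite pow1; ring|].
      apply is_series_unique, is_series_Im, asum_is_series, Hl. }
  rewrite h0 in h01; unfold h in h01; rewrite <- f1, Cmult_1_l in h01; unfold Cpower.
  replace (- c * Clog (1 - w)) with (- (c * Clog (1 - w))) by ring.
  transitivity (l * (Cexp (c * Clog (1 - w)) * Cexp (- (c * Clog (1 - w))))).
  - rewrite <- Cexp_plus, Cplus_opp_r, Cexp_0; ring.
  - rewrite Cmult_assoc, <- h01; ring.
Qed.

(** * Transformations of hypergeometric series *)

Lemma Cmod_mult_le x y A B : (Cmod x <= A)%R -> (Cmod y <= B)%R -> (Cmod (x * y) <= A * B)%R.
Proof. intros; rewrite Cmod_mult; apply Rmult_le_compat; auto using Cmod_ge_0. Qed.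

Lemma Cmod_pow_le x r n : (Cmod x <= r)%R -> (Cmod (x ^ n) <= r ^ n)%R.
Proof. intros; rewrite Cmod_pow; apply pow_incr; split; auto using Cmod_ge_0. Qed.

Lemma Cmod_sign n : (Cmod ((-(1)) ^ n) <= 1)%R.
Proof. rewrite Cmod_pow, Cmod_m1, pow1; lra. Qed.

Lemma Cmod_add_INR_le c (M m : nat) : (Cmod c <= INR M)%R -> (Cmod (c + INR m) <= INR (M + m))%R.
Proof.
  intros H; eapply Rle_trans; [apply Cmod_triangle|]; rewrite Cmod_INR, plus_INR; lra.
Qed.

Lemma bounded_sums_half_pow2 :
  bounded_sums (fun p : nat * nat => ((1 / 2) ^ fst p * (1 / 2) ^ snd p)%R).
Proof.
  apply (bounded_sums_prod (fun n => (1 / 2) ^ n)%R (fun n => (1 / 2) ^ n)%R);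
    try apply bounded_sums_half_pow; intros; apply pow_le; lra.
Qed.

Lemma asum_antidiag2 (u : nat * nat -> C) l : asum u l ->
  asum (antidiag (fun n d => u (n, d))) l.
Proof.
  intros H.
  assert (H1 := asum_reindex (fun q : (nat * nat) * unit => fst q) (fun p => (p, tt)) u l
    (fun _ => eq_refl) ltac:(intros [? []]; reflexivity) H).
  apply asum_antidiag in H1.
  apply (asum_reindex (fun N => (N, tt)) (fun q : nat * unit => fst q)) in H1;
    [exact H1 | intros [? []]; reflexivity | reflexivity].
Qed.

Lemma Cpower_plus z a b : Cpower z (a + b) = Cpower z a * Cpower z b.
Proof. unfold Cpower; rewrite <- Cexp_plus; f_equal; ring. Qed.

Lemma Cpower_neq0 z a : Cpower z a <> 0.
Proof. apply Cexp_neq0. Qed.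

Lemma Cpower_opp z a : Cpower z (- a) = / Cpower z a.
Proof.
  assert (H : Cpower z a * Cpower z (- a) = 1).
  { rewrite <- Cpower_plus, Cplus_opp_r; unfold Cpower; rewrite Cmult_0_l; apply Cexp_0. }
  replace (Cpower z (- a)) with (Cpower z a * Cpower z (- a) / Cpower z a)
    by (field; apply Cpower_neq0).
  rewrite H; field; apply Cpower_neq0.
Qed.

Lemma Cpower_INR z n : (0 < Re z)%R -> Cpower z (INR n) = z ^ n.
Proof. intros H; unfold Cpower; rewrite Cexp_INR_mult, Cexp_Clog by assumption; reflexivity. Qed.

Lemma Cmod_lt_1_Re w : (Cmod w < 1)%R -> (0 < Re (1 - w))%R.
Proof.
  intros H; pose proof (re_le_Cmod w) as R; destruct w as [x y]; simpl in *.
  unfold Rabs in R; destruct (Rcase_abs _) in R; lra.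
Qed.

Lemma Re_pos_neq0 z : (0 < Re z)%R -> z <> 0.
Proof. intros H ->; simpl in H; lra. Qed.

Lemma hyp2F1_asum a b c : not_nonpos_int c ->
  exists rho, (0 < rho)%R /\
  forall z, (Cmod z <= rho)%R -> exists l, asum (hyp2F1_term a b c z) l.
Proof.
  intros hc; destruct (Cmod_poch_ratio b c hc) as [K [HK BK]].
  destruct (nat_upper_bound (Cmod a)) as [M HM].
  exists (/ (4 * K))%R; split; [apply Rinv_0_lt_compat; lra|]; intros z Hz; apply asum_exists.
  apply (bounded_sums_le _ (fun n => (1 / 2) ^ n)%R (2 ^ M)); [apply pow_le; lra | |
    apply bounded_sums_half_pow].
  intros n.
  replace (hyp2F1_term a b c z n) with (poch a n / cfact n * (poch b n / poch c n) * z ^ n)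
    by (unfold hyp2F1_term; fold (cfact n); field; nz).
  apply Rle_trans with (2 ^ (M + n) * K ^ n * (/ (4 * K)) ^ n)%R.
  - repeat apply Cmod_mult_le; [apply Cmod_poch_div_cfact, HM | apply BK | apply Cmod_pow_le, Hz].
  - right; rewrite pow_add, !Rmult_assoc, <- !Rpow_mult_distr; do 2 f_equal; field; lra.
Qed.

(** Since [(X/(X-1))^k = (-X)^k (1-X)^(-k)], the factor [(1-X)^(-a-k)] is expanded with index [j].
    Summing over [j] gives back the series in [X/(X-1)]; summing along [k + j = N] is a
    Chu-Vandermonde sum and gives the series in [X]. *)
Lemma pfaff a b c : not_nonpos_int c ->
  exists rho, (0 < rho)%R /\
  forall X, (Cmod X <= rho)%R -> exists g,
    asum (hyp2F1_term a (c - b) c (X / (X - 1))) g /\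
    asum (hyp2F1_term a b c X) (Cpower (1 - X) (- a) * g).
Proof.
  intros hc; destruct (Cmod_poch_ratio (c - b) c hc) as [K [HK BK]].
  destruct (nat_upper_bound (Cmod a)) as [M HM].
  (* The ratio in [k] is [4 K rho = 1/2]; the 8 also ensures [rho <= 1/8], as the binomial series
     requires. *)
  set (rho := (/ (8 * K))%R).
  assert (Kr : (K * rho = 1 / 8)%R) by (unfold rho; field; lra).
  assert (P : (0 < rho)%R) by (apply Rinv_0_lt_compat; lra).
  assert (r8 : (rho <= 1 / 8)%R) by nra.
  exists rho; split; [assumption|]; intros X HX.
  set (u := fun p : nat * nat => let (k, j) := p in
    poch a k / cfact k * (poch (c - b) k / poch c k) * (-(1)) ^ k
    * (poch (a + INR k) j / cfact j) * X ^ k * X ^ j).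
  destruct (asum_exists u) as [l Hl].
  { apply (bounded_sums_le _ _ (2 ^ M * 2 ^ M)) with (3 := bounded_sums_half_pow2);
      [apply Rmult_le_pos; apply pow_le; lra|].
    intros [k j]; simpl fst; simpl snd; unfold u.
    apply Rle_trans with (2 ^ (M + k) * K ^ k * 1 * 2 ^ (M + k + j) * rho ^ k * rho ^ j)%R.
    - repeat apply Cmod_mult_le.
      + apply Cmod_poch_div_cfact, HM.
      + apply BK.
      + apply Cmod_sign.
      + apply Cmod_poch_div_cfact, Cmod_add_INR_le, HM.
      + apply Cmod_pow_le, HX.
      + apply Cmod_pow_le, HX.
    - replace (2 ^ (M + k) * K ^ k * 1 * 2 ^ (M + k + j) * rho ^ k * rho ^ j)%R
        with (2 ^ M * 2 ^ M * ((2 * 2 * K * rho) ^ k * (2 * rho) ^ j))%R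
        by (rewrite !pow_add, !Rpow_mult_distr; ring).
      apply Rmult_le_compat_l; [apply Rmult_le_pos; apply pow_le; lra|].
      apply Rmult_le_compat; try (apply pow_le; nra); apply pow_incr; nra. }
  assert (ReX : (0 < Re (1 - X))%R) by (apply Cmod_lt_1_Re; lra).
  assert (nX := Re_pos_neq0 _ ReX).
  assert (nX' : X - 1 <> 0).
  { intros E; apply nX; replace (1 - X) with (- (X - 1)) by ring; rewrite E; ring. }
  set (k0 := Cpower (1 - X) (- a)).
  assert (nk0 : k0 <> 0) by apply Cpower_neq0.
  exists (/ k0 * l); split.
  - assert (H : asum (fun k => k0 * hyp2F1_term a (c - b) c (X / (X - 1)) k) l).
    { apply (asum_fst u); [assumption|]; intros k.
      assert (B := proj2 (binomial_asum (a + INR k) X ltac:(lra))).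
      apply (has_sum_scal (poch a k / cfact k * (poch (c - b) k / poch c k) * (-(1)) ^ k * X ^ k))
        in B.
      replace (k0 * hyp2F1_term a (c - b) c (X / (X - 1)) k) with
        (poch a k / cfact k * (poch (c - b) k / poch c k) * (-(1)) ^ k * X ^ k
         * Cpower (1 - X) (- (a + INR k))).
      - revert B; apply has_sum_ext; intros j; unfold u; ring.
      - replace (- (a + INR k)) with (- a + - INR k) by ring.
        rewrite Cpower_plus, (Cpower_opp _ (INR k)), Cpower_INR by assumption.
        fold k0; unfold hyp2F1_term; fold (cfact k).
        replace (X / (X - 1)) with (-(1) * X * / (1 - X)).
        2:{ field; split; assumption. }
        rewrite !Cpow_mult_l, Cpow_inv by assumption.
        field; nz; apply Cpow_nz; assumption. }
    apply (asum_scal (/ k0)) in H; revert H; apply asum_ext; intros k; field; assumption.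
  - replace (k0 * (/ k0 * l)) with l by (field; assumption).
    apply asum_antidiag2 in Hl; revert Hl; apply asum_ext; intros N.
    transitivity (poch a N * X ^ N
      * bsum (fun k _ => (-(1)) ^ k * poch (c - b) (0 + k) / poch c (0 + k)) N).
    + unfold bsum; rewrite <- antidiag_scal; apply antidiag_ext; intros k d E; unfold u.
      rewrite <- E, poch_add, Cpow_add_r; simpl (0 + k)%nat; field; nz.
    + rewrite bsum_vandermonde_sign by assumption; replace (c - (c - b)) with b by ring.
      unfold hyp2F1_term; fold (cfact N); simpl; field; nz.
Qed.

Lemma bsum_pow w n : bsum (fun k _ => w ^ k) n = (1 + w) ^ n / cfact n.
Proof.
  induction n as [|n IH].
  - unfold bsum, antidiag; simpl; rewrite !cfact_0; field; nz.
  - apply bsum_eq_step.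
    replace (bsum (fun k _ => w ^ S k) n) with (w * bsum (fun k _ => w ^ k) n).
    + rewrite IH, Cpow_S, cfact_S; field; nz.
    + unfold bsum; rewrite <- antidiag_scal; apply antidiag_ext; intros k d _.
      rewrite Cpow_S; unfold Cdiv; ring.
Qed.

Definition appellF4_term (al be g g' x y : C) (p : nat * nat) : C :=
  let (m, k) := p in
  poch al (m + k) * poch be (m + k) / (poch g m * poch g' k * cfact m * cfact k)
  * x ^ m * y ^ k.

Lemma appellF4_factor al be g g' :
  not_nonpos_int g -> not_nonpos_int g' -> g + g' = al + be + 1 ->
  exists rho, (0 < rho)%R /\
  forall X Y, (Cmod X <= rho)%R -> (Cmod Y <= rho)%R -> exists G H,
    asum (hyp2F1_term al be g X) G /\ asum (hyp2F1_term al be g' Y) H /\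
    asum (appellF4_term al be g g' (X * (1 - Y)) (Y * (1 - X))) (G * H).
Proof.
  intros hg hg' hgg.
  destruct (hyp2F1_asum al be g hg) as [r1 [P1 S1]].
  destruct (hyp2F1_asum al be g' hg') as [r2 [P2 S2]].
  destruct (Cmod_poch_ratio be g hg) as [K1 [HK1 BK1]].
  (* The symbol facing [poch g' k] is [poch (be + INR m) k], and the ratio bound would then depend
     on [m]. Passing through [cfact k = poch 1 k] keeps the constant uniform. *)
  destruct (Cmod_poch_ratio 1 g' hg') as [K2 [HK2 BK2]].
  destruct (nat_upper_bound (Rmax (Cmod al) (Cmod be))) as [M HM].
  assert (Ma : (Cmod al <= INR M)%R) by (eapply Rle_trans; [apply Rmax_l | exact HM]).
  assert (Mb : (Cmod be <= INR M)%R) by (eapply Rle_trans; [apply Rmax_r | exact HM]).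
  (* The ratios to be kept at most 1/2 are [16 K1 rho] in [m] and [8 K2 rho] in [k]. *)
  set (r3 := (/ (32 * (K1 * K2)))%R).
  assert (K12 : (1 <= K1 * K2)%R) by nra.
  assert (P3 : (0 < r3)%R) by (apply Rinv_0_lt_compat; lra).
  assert (E3 : (K1 * K2 * r3 = 1 / 32)%R) by (unfold r3; field; lra).
  set (rho := Rmin r1 (Rmin r2 r3)).
  assert (P : (0 < rho)%R) by (repeat apply Rmin_glb_lt; assumption).
  assert (L1 : (rho <= r1)%R) by apply Rmin_l.
  assert (L2 : (rho <= r2)%R) by (eapply Rle_trans; [apply Rmin_r | apply Rmin_l]).
  assert (L3 : (rho <= r3)%R) by (eapply Rle_trans; [apply Rmin_r | apply Rmin_r]).
  assert (K1r : (K1 * rho <= 1 / 32)%R) by nra.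
  assert (K2r : (K2 * rho <= 1 / 32)%R) by nra.
  exists rho; split; [assumption|]; intros X Y HX HY.
  destruct (S1 X) as [G HG]; [lra|]; destruct (S2 Y) as [H HH]; [lra|].
  exists G, H; split; [assumption|]; split; [assumption|].
  (* [(X(1-Y))^m] and [(Y(1-X))^k] are expanded with [m = p + i] and [k = r + j], where [p] and [r]
     count the factors [-Y] and [-X]. The monomial is [X^(i+p+r) Y^(j+p+r)], so [l = p + r] is the
     index to collapse for the product of series. *)
  set (u := fun q : (nat * nat) * (nat * nat) =>
    let '((p, i), (r, j)) := q in
    poch al (p + i + (r + j)) * poch be (p + i + (r + j))
    / (poch g (p + i) * poch g' (r + j) * cfact p * cfact i * cfact r * cfact j)
    * (-(1)) ^ p * (-(1)) ^ r * X ^ (p + i) * Y ^ p * Y ^ (r + j) * X ^ r).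
  destruct (asum_exists u) as [l Hl].
  { assert (B4 := bounded_sums_prod _ _
      (fun p => Rmult_le_pos _ _ (pow_le (1 / 2) (fst p) ltac:(lra)) (pow_le (1 / 2) (snd p) ltac:(lra)))
      (fun p => Rmult_le_pos _ _ (pow_le (1 / 2) (fst p) ltac:(lra)) (pow_le (1 / 2) (snd p) ltac:(lra)))
      bounded_sums_half_pow2 bounded_sums_half_pow2).
    apply (bounded_sums_le _ _ (4 * (2 ^ M * 2 ^ M * 2 ^ M))%R) with (3 := B4);
      [repeat apply Rmult_le_pos; try apply pow_le; lra|].
    intros [[p i] [r j]]; simpl fst; simpl snd; unfold u.
    set (m := (p + i)%nat); set (k := (r + j)%nat).
    replace (poch al (m + k) * poch be (m + k)
      / (poch g m * poch g' k * cfact p * cfact i * cfact r * cfact j)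
      * (-(1)) ^ p * (-(1)) ^ r * X ^ m * Y ^ p * Y ^ k * X ^ r)
    with (poch al m / cfact m * (poch (al + INR m) k / cfact k) * (poch be m / poch g m)
      * (poch (be + INR m) k / cfact k) * (poch 1 k / poch g' k)
      * (cfact m / (cfact p * cfact i)) * (cfact k / (cfact r * cfact j))
      * (-(1)) ^ p * (-(1)) ^ r * X ^ m * Y ^ p * Y ^ k * X ^ r)
    by (rewrite !poch_add, poch_1; field; nz).
    apply Rle_trans with (2 ^ (M + m) * 2 ^ (M + m + k) * K1 ^ m * 2 ^ (M + m + k) * K2 ^ k
      * 2 ^ (m + 1) * 2 ^ (k + 1) * 1 * 1 * rho ^ m * 1 ^ p * rho ^ k * 1 ^ r)%R.
    - assert (r1' : (rho <= 1)%R) by nra.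
      repeat apply Cmod_mult_le;
        try apply Cmod_sign; try (apply Cmod_pow_le; lra).
      + apply Cmod_poch_div_cfact, Ma.
      + apply Cmod_poch_div_cfact, Cmod_add_INR_le, Ma.
      + apply BK1.
      + apply Cmod_poch_div_cfact, Cmod_add_INR_le, Mb.
      + apply BK2.
      + apply Cmod_binomial.
      + apply Cmod_binomial.
    - replace (2 ^ (M + m) * 2 ^ (M + m + k) * K1 ^ m * 2 ^ (M + m + k) * K2 ^ k
      * 2 ^ (m + 1) * 2 ^ (k + 1) * 1 * 1 * rho ^ m * 1 ^ p * rho ^ k * 1 ^ r)%R
        with (4 * (2 ^ M * 2 ^ M * 2 ^ M) *
          ((2 * 2 * 2 * 2 * (K1 * rho)) ^ m * (2 * 2 * 2 * (K2 * rho)) ^ k))%R.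
      2:{ rewrite !pow_add, !Rpow_mult_distr, !pow1; simpl pow; ring. }
      apply Rmult_le_compat_l; [repeat apply Rmult_le_pos; try apply pow_le; lra|].
      rewrite <- !pow_add; fold m; fold k; rewrite (pow_add _ m k).
      apply Rmult_le_compat; try (apply pow_le; nra); apply pow_incr; nra. }
  assert (l_eq : l = G * H).
  { assert (E1 := asum_reindex
      (fun q : (nat * nat) * (nat * nat) => let '((p, r), (i, j)) := q in ((p, i), (r, j)))
      (fun q : (nat * nat) * (nat * nat) => let '((p, i), (r, j)) := q in ((p, r), (i, j)))
      u l ltac:(intros [[? ?] [? ?]]; reflexivity) ltac:(intros [[? ?] [? ?]]; reflexivity) Hl).
    apply asum_antidiag in E1.
    apply (asum_finite_fiber (fun q : nat * (nat * nat) =>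
        (fst (snd q) + fst q, snd (snd q) + fst q)%nat)
      (fun q => map (fun l => (l, (fst q - l, snd q - l)%nat)) (seq 0 (S (Nat.min (fst q) (snd q))))))
      in E1.
    - apply (has_sum_unique _ _ _ (proj2 E1)).
      assert (E2 := proj2 (asum_prod _ _ _ _ HG HH)); revert E2; apply has_sum_ext.
      intros [i j]; simpl fst; simpl snd; rewrite lsum_map, lsum_seq.
      transitivity (X ^ i * Y ^ j / (poch g i * poch g' j)
        * csum (bailey_term al be i j) (S (Nat.min i j))).
      + rewrite bailey_sum; unfold hyp2F1_term; fold (cfact i); fold (cfact j); field; nz.
      + rewrite <- csum_scal; apply csum_ext; intros k Hk; simpl fst; simpl snd.
        assert (Hi : (i - k + k = i)%nat) by lia; assert (Hj : (j - k + k = j)%nat) by lia.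
        assert (Hij : (i - k + (j - k) + k = i + j - k)%nat) by lia.
        assert (V := bsum_vandermonde_inv g g' (i - k) (j - k) k hg hg').
        rewrite Hi, Hj, Hij in V.
        (* The only use of the relation between the parameters: it turns the Chu-Vandermonde
           numerator into the third symbol of [bailey_term]. *)
        replace (g + g' - 1) with (al + be) in V by (rewrite hgg; ring).
        transitivity ((-(1)) ^ k * poch al (i + j - k) * poch be (i + j - k) * X ^ i * Y ^ j
          / (cfact (i - k) * cfact (j - k))
          * bsum (fun p r => / (poch g (p + (i - k)) * poch g' (r + (j - k)))) k).
        * rewrite V; unfold bailey_term; field; nz.
        * unfold bsum; rewrite <- antidiag_scal; apply antidiag_ext; intros p r E; unfold u.
          replace (p + (i - k) + (r + (j - k)))%nat with (i + j - k)%nat by lia.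
          assert (EX : X ^ i = X ^ (p + (i - k)) * X ^ r)
            by (rewrite <- Cpow_add_r; f_equal; lia).
          assert (EY : Y ^ j = Y ^ p * Y ^ (r + (j - k)))
            by (rewrite <- Cpow_add_r; f_equal; lia).
          assert (Es : (-(1)) ^ k = (-(1)) ^ p * (-(1)) ^ r)
            by (rewrite <- Cpow_add_r; f_equal; lia).
          rewrite EX, EY, Es; field; nz.
    - intros [i j]; apply FinFun.Injective_map_NoDup; [intros ? ? E; congruence | apply seq_NoDup].
    - intros [k [i' j']] [i j]; rewrite in_map_iff; simpl fst; simpl snd; split.
      + intros [x [E Hx]]; apply in_seq in Hx; injection E; intros; subst; f_equal; lia.
      + intros E; injection E; intros <- <-; exists k; split.
        * f_equal; f_equal; lia.
        * apply in_seq; lia. }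
  rewrite <- l_eq.
  (* The same family is summed the other way: collapsing [(p, i)] and [(r, j)] restores [(1 - Y)^m]
     and [(1 - X)^k], hence the F4 series. *)
  apply asum_antidiag in Hl.
  apply (asum_reindex (fun q : (nat * nat) * nat => (snd q, fst q)) (fun q => (snd q, fst q))) in Hl;
    [|intros [? ?]; reflexivity | intros [? ?]; reflexivity].
  apply asum_antidiag in Hl.
  apply (asum_reindex (fun q : nat * nat => (snd q, fst q)) (fun q => (snd q, fst q))) in Hl;
    [|intros [? ?]; reflexivity | intros [? ?]; reflexivity].
  revert Hl; apply asum_ext; intros [m k]; simpl fst; simpl snd.
  set (A := poch al (m + k) * poch be (m + k) / (poch g m * poch g' k) * X ^ m * Y ^ k).
  transitivity (A * bsum (fun p _ => (- Y) ^ p) m * bsum (fun r _ => (- X) ^ r) k).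
  - transitivity (antidiag (fun r j => A * bsum (fun p _ => (- Y) ^ p) m
      * ((- X) ^ r / (cfact r * cfact j))) k); [|apply antidiag_scal].
    apply antidiag_ext; intros r j Ek.
    transitivity (antidiag (fun p i => A * ((- X) ^ r / (cfact r * cfact j))
      * ((- Y) ^ p / (cfact p * cfact i))) m).
    + apply antidiag_ext; intros p i Em; unfold u, A; rewrite Em, Ek.
      replace (- X) with (-(1) * X) by ring; replace (- Y) with (-(1) * Y) by ring.
      rewrite !Cpow_mult_l; field; nz.
    + rewrite antidiag_scal; fold (bsum (fun p _ => (- Y) ^ p) m); ring.
  - rewrite !bsum_pow; unfold A, appellF4_term.
    replace (1 - Y) with (1 + - Y) by ring; replace (1 - X) with (1 + - X) by ring.
    rewrite !Cpow_mult_l; field; nz.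
Qed.

(** Both arguments have denominator [(1 + z)^2], so term [(n, m)] carries [(1 + z)^(-2(n+m))]. With
    the prefactor it becomes a binomial series in [j]; collapsing [n + j] at fixed [m] gives
    Watson's sum with [A = a + m], whose vanishing at odd order leaves powers of [z^2]. *)
Lemma appellF2_quadratic a b1 b2 :
  not_nonpos_int (2 * b1) -> not_nonpos_int (2 * b2) -> not_nonpos_int (b1 + 1 / 2) ->
  a - b1 + 1 / 2 = b2 ->
  exists rho, (0 < rho)%R /\
  forall y z, (Cmod y <= rho)%R -> (Cmod z <= rho)%R -> exists l,
    asum (appellF4_term a b2 (2 * b2) (b1 + 1 / 2) y (z ^ 2)) l /\
    asum (appellF2_term a b1 b2 (2 * b1) (2 * b2) (4 * z / (1 + z) ^ 2) (y / (1 + z) ^ 2))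
      (Cpower (1 + z) (2 * a) * l).
Proof.
  intros h1 h2 h1' hab.
  destruct (Cmod_poch_ratio b1 (2 * b1) h1) as [K1 [HK1 BK1]].
  destruct (Cmod_poch_ratio b2 (2 * b2) h2) as [K2 [HK2 BK2]].
  destruct (nat_upper_bound (Cmod a)) as [M HM].
  (* The ratios are [32 K1 rho] in [n], [16 K2 rho] in [m] and [2 rho] in [j]; the first one
     dictates 64. *)
  set (rho := (/ (64 * (K1 * K2)))%R).
  assert (K12 : (1 <= K1 * K2)%R) by nra.
  assert (P : (0 < rho)%R) by (apply Rinv_0_lt_compat; lra).
  assert (E : (K1 * K2 * rho = 1 / 64)%R) by (unfold rho; field; lra).
  assert (K1r : (K1 * rho <= 1 / 64)%R) by nra.
  assert (K2r : (K2 * rho <= 1 / 64)%R) by nra.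
  assert (r64 : (rho <= 1 / 64)%R) by nra.
  exists rho; split; [assumption|]; intros y z Hy Hz.
  set (u := fun q : (nat * nat) * nat => let '((n, m), j) := q in
    poch a m / cfact m * (poch (a + INR m) n / cfact n) * (poch b1 n / poch (2 * b1) n)
    * (poch b2 m / poch (2 * b2) m) * 4 ^ n
    * (poch (2 * a + INR (2 * (n + m))) j / cfact j) * (-(1)) ^ j * y ^ m * z ^ n * z ^ j).
  destruct (asum_exists u) as [l Hl].
  { assert (B3 := bounded_sums_prod _ _
      (fun p => Rmult_le_pos _ _ (pow_le (1 / 2) (fst p) ltac:(lra)) (pow_le (1 / 2) (snd p) ltac:(lra)))
      (fun n => pow_le (1 / 2) n ltac:(lra)) bounded_sums_half_pow2 bounded_sums_half_pow).
    apply (bounded_sums_le _ _ (2 ^ M * 2 ^ M * 2 ^ M * 2 ^ M)%R) with (3 := B3);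
      [repeat apply Rmult_le_pos; apply pow_le; lra|].
    intros [[n m] j]; simpl fst; simpl snd; unfold u.
    apply Rle_trans with (2 ^ (M + m) * 2 ^ (M + m + n) * K1 ^ n * K2 ^ m * 4 ^ n
      * 2 ^ (M + M + 2 * (n + m) + j) * 1 * rho ^ m * rho ^ n * rho ^ j)%R.
    - repeat apply Cmod_mult_le; try apply Cmod_sign; try (apply Cmod_pow_le; assumption).
      + apply Cmod_poch_div_cfact, HM.
      + apply Cmod_poch_div_cfact, Cmod_add_INR_le, HM.
      + apply BK1.
      + apply BK2.
      + apply Cmod_pow_le; rewrite Cmod_R, Rabs_pos_eq; lra.
      + apply Cmod_poch_div_cfact, Cmod_add_INR_le.
        rewrite Cmod_mult, Cmod_R, Rabs_pos_eq, plus_INR by lra; lra.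
    - replace (2 ^ (M + m) * 2 ^ (M + m + n) * K1 ^ n * K2 ^ m * 4 ^ n
        * 2 ^ (M + M + 2 * (n + m) + j) * 1 * rho ^ m * rho ^ n * rho ^ j)%R
      with (2 ^ M * 2 ^ M * 2 ^ M * 2 ^ M
        * ((2 * 4 * (2 * 2) * (K1 * rho)) ^ n * (2 * 2 * (2 * 2) * (K2 * rho)) ^ m
          * (2 * rho) ^ j))%R.
      2:{ replace (2 * (n + m))%nat with (n + n + m + m)%nat by lia.
          rewrite !pow_add, !Rpow_mult_distr; ring. }
      apply Rmult_le_compat_l; [repeat apply Rmult_le_pos; apply pow_le; lra|].
      apply Rmult_le_compat; try (apply pow_le; nra);
        [apply Rmult_le_pos; apply pow_le; nra | | apply pow_incr; nra].
      apply Rmult_le_compat; try (apply pow_le; nra); apply pow_incr; nra. }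
  assert (Hz1 : (Cmod (- z) < 1)%R) by (rewrite Cmod_opp; lra).
  assert (Rz : (0 < Re (1 + z))%R).
  { replace (1 + z) with (1 - - z) by ring; apply Cmod_lt_1_Re, Hz1. }
  assert (nz1 := Re_pos_neq0 _ Rz).
  exists l; split.
  - apply (asum_reindex (fun q : (nat * nat) * nat => let '((n, j), m) := q in ((n, m), j))
      (fun q : (nat * nat) * nat => let '((n, m), j) := q in ((n, j), m))) in Hl;
      [|intros [[? ?] ?]; reflexivity | intros [[? ?] ?]; reflexivity].
    apply asum_antidiag in Hl.
    set (v := fun p : nat * nat => _) in Hl.
    assert (Ev : forall N m, v (N, m) = poch a m * poch b2 m / (poch (2 * b2) m * cfact m)
      * y ^ m * z ^ N * antidiag (watson_term (a + INR m) b1) N).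
    { intros N m; unfold v; simpl fst; simpl snd; rewrite <- antidiag_scal.
      apply antidiag_ext; intros n j En; unfold u, watson_term.
      replace (2 * (a + INR m) + 2 * INR n) with (2 * a + INR (2 * (n + m))).
      2:{ rewrite mult_INR, RtoC_mult, RtoC_INR_plus; simpl (INR 2).
          replace (RtoC (1 + 1)) with (RtoC 2) by reflexivity; ring. }
      rewrite <- En, Cpow_add_r; field; nz. }
    clearbody v.
    (* The orders [2k] and [2k + 1] share the index [k], the odd one contributing zero. *)
    apply (asum_finite_fiber (fun q : nat * nat => (snd q, Nat.div2 (fst q)))
      (fun q => (2 * snd q, fst q)%nat :: (S (2 * snd q), fst q) :: nil)) in Hl.
    + revert Hl; apply asum_ext; intros [m k]; simpl fst; simpl snd.
      change (v (2 * k, m)%nat + (v (S (2 * k), m) + 0)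
        = appellF4_term a b2 (2 * b2) (b1 + 1 / 2) y (z ^ 2) (m, k)).
      rewrite !Ev, watson_even, watson_odd by assumption.
      (* Here [hab] is used: Watson's symbol becomes [poch (b2 + INR m) k], which completes
         [poch b2 m] to [poch b2 (m + k)]. *)
      replace (a + INR m - b1 + 1 / 2) with (b2 + INR m) by (rewrite <- hab; ring).
      unfold appellF4_term; rewrite !poch_add, Cpow_mult_r; field; nz.
    + intros [m k]; repeat constructor; simpl; [intros [E'|[]] | tauto].
      injection E'; lia.
    + intros [N m'] [m k]; simpl fst; simpl snd; split.
      * intros [E'|[E'|[]]]; injection E'; intros; subst; f_equal;
          [apply Nat.div2_double | apply Nat.div2_succ_double].
      * intros E'; injection E'; intros <- <-.
        destruct (Nat.Even_or_Odd N) as [[x ->]|[x ->]].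
        -- left; rewrite Nat.div2_double; reflexivity.
        -- right; left; rewrite Nat.add_1_r, Nat.div2_succ_double; reflexivity.
  - assert (H : asum (fun p => Cpower (1 + z) (- (2 * a))
      * appellF2_term a b1 b2 (2 * b1) (2 * b2) (4 * z / (1 + z) ^ 2) (y / (1 + z) ^ 2) p) l).
    { apply (asum_fst u); [assumption|]; intros [n m].
      assert (B := proj2 (binomial_asum (2 * a + INR (2 * (n + m))) (- z)
        ltac:(rewrite Cmod_opp; lra))).
      set (cf := poch a m / cfact m * (poch (a + INR m) n / cfact n)
        * (poch b1 n / poch (2 * b1) n) * (poch b2 m / poch (2 * b2) m) * 4 ^ n * y ^ m * z ^ n).
      apply (has_sum_scal cf) in B.
      match goal with |- has_sum _ ?r => replace r with
        (cf * Cpower (1 - - z) (- (2 * a + INR (2 * (n + m))))) end.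
      - revert B; apply has_sum_ext; intros j; unfold u, cf.
        replace (- z) with (-(1) * z) by ring; rewrite Cpow_mult_l; ring.
      - replace (1 - - z) with (1 + z) by ring.
        replace (- (2 * a + INR (2 * (n + m)))) with (- (2 * a) + - INR (2 * (n + m))) by ring.
        rewrite Cpower_plus, (Cpower_opp _ (INR _)), Cpower_INR by assumption.
        unfold appellF2_term, cf; fold (cfact n); fold (cfact m).
        unfold Cdiv; rewrite !Cpow_mult_l, !Cpow_inv by (apply Cpow_nz; assumption).
        rewrite <- !Cpow_mult_r, !Nat.mul_add_distr_l, Cpow_add_r, (Nat.add_comm n m), poch_add.
        field; nz; apply Cpow_nz; assumption. }
    apply (asum_scal (Cpower (1 + z) (2 * a))) in H; revert H; apply asum_ext; intros p.
    rewrite Cpower_opp; field; apply Cpower_neq0.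
Qed.

(** * Assembly near the origin *)

Lemma Cmod_1_add_ge w : (Cmod w <= 1 / 2)%R -> (1 / 2 <= Cmod (1 + w))%R.
Proof.
  intros H; pose proof (Cmod_triangle (1 + w) (- w)) as T; rewrite Cmod_opp in T.
  replace (1 + w + - w) with (RtoC 1) in T by ring; rewrite Cmod_1 in T; lra.
Qed.

Lemma Cmod_div_le x y r : (Cmod x <= r)%R -> (1 / 2 <= Cmod y)%R -> (Cmod (x / y) <= 2 * r)%R.
Proof.
  intros Hx Hy; rewrite Cmod_div by (apply Cmod_gt_0; lra).
  apply Rle_div_l; [lra|]; pose proof (Cmod_ge_0 x); nra.
Qed.

Theorem mainTheorem5 (b1 b2 : C)
  (hb1 : not_nonpos_int (2 * b1))
  (hb2 : not_nonpos_int (2 * b2))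
  (hb1' : not_nonpos_int (b1 + 1 / 2)) :
  exists delta : R, (0 < delta)%R /\
  forall s t : C, (Cmod s < delta)%R -> (Cmod t < delta)%R ->
  exists F G H : C,
    is_appellF2 (b1 + b2 - 1 / 2) b1 b2 (2 * b1) (2 * b2)
      (4 * (1 - s ^ 2) * t / (1 + s + t - s * t) ^ 2)
      (4 * (1 - t ^ 2) * s / (1 + s + t - s * t) ^ 2) F /\
    is_hyp2F1 (b1 + b2 - 1 / 2) b2 (2 * b2) (- (4 * s / (s - 1) ^ 2)) G /\
    is_hyp2F1 (b1 + b2 - 1 / 2) b2 (b1 + 1 / 2) (t ^ 2) H /\
    F = Cpower ((1 + s + t - s * t) / (1 - s)) (2 * b1 + 2 * b2 - 1) * G * H.
Proof.
  set (a := b1 + b2 - 1 / 2).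
  destruct (appellF4_factor a b2 (2 * b2) (b1 + 1 / 2) hb2 hb1') as [r1 [P1 S1]];
    [unfold a; field|].
  destruct (appellF2_quadratic a b1 b2 hb1 hb2 hb1') as [r2 [P2 S2]]; [unfold a; field|].
  destruct (pfaff a b2 (2 * b2) hb2) as [r3 [P3 S3]].
  set (r := Rmin (Rmin r1 r2) (Rmin r3 1)).
  assert (P : (0 < r)%R) by (repeat apply Rmin_glb_lt; lra).
  assert (L1 : (r <= r1)%R) by (eapply Rle_trans; [apply Rmin_l | apply Rmin_l]).
  assert (L2 : (r <= r2)%R) by (eapply Rle_trans; [apply Rmin_l | apply Rmin_r]).
  assert (L3 : (r <= r3)%R) by (eapply Rle_trans; [apply Rmin_r | apply Rmin_l]).
  assert (L4 : (r <= 1)%R) by (eapply Rle_trans; [apply Rmin_r | apply Rmin_r]).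
  (* With [d = r / 64], the arguments [X], [X (1 - Y)], [z], [Y] are bounded by [16 d], [32 d],
     [2 d], [d], all at most [r]; moreover [d <= 1/64] places [sg], [tau] and [1 + z] near 1. *)
  exists (r / 64)%R; split; [lra|]; intros s t Hs Ht.
  set (d := (r / 64)%R) in *.
  assert (Hd : (64 * d <= 1)%R) by (unfold d; lra).
  assert (Hr : (r = 64 * d)%R) by (unfold d; lra).
  clearbody d; pose proof (Cmod_ge_0 s) as s0; pose proof (Cmod_ge_0 t) as t0.
  assert (Gp : (1 / 2 <= Cmod (1 + s))%R) by (apply Cmod_1_add_ge; lra).
  assert (Gm : (1 / 2 <= Cmod (1 - s))%R) by (apply Cmod_1_add_ge; rewrite Cmod_opp; lra).
  assert (np : 1 + s <> 0) by (apply Cmod_gt_0; lra).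
  assert (nm : 1 - s <> 0) by (apply Cmod_gt_0; lra).
  assert (nm' : s - 1 <> 0).
  { intros E; apply nm; replace (1 - s) with (- (s - 1)) by ring; rewrite E; ring. }
  set (tau := (1 - s) / (1 + s)); set (sg := (1 + s) / (1 - s)).
  set (z := t * tau); set (X := 4 * s / (1 + s) ^ 2); set (Y := t ^ 2).
  assert (Mtau : near1 tau).
  { unfold near1; replace (tau - 1) with (- (2) * s / (1 + s)) by (unfold tau; field; assumption).
    eapply Rle_lt_trans; [apply (Cmod_div_le _ _ (2 * d)); [|assumption]|lra].
    rewrite Cmod_mult, Cmod_opp, Cmod_R, Rabs_pos_eq; lra. }
  assert (Msg : near1 sg).
  { unfold near1; replace (sg - 1) with (2 * s / (1 - s)) by (unfold sg; field; assumption).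
    eapply Rle_lt_trans; [apply (Cmod_div_le _ _ (2 * d)); [|assumption]|lra].
    rewrite Cmod_mult, Cmod_R, Rabs_pos_eq; lra. }
  assert (Bz : (Cmod z <= 2 * d)%R).
  { unfold z; rewrite Cmod_mult.
    assert (Cmod tau <= 2)%R.
    { replace tau with (tau - 1 + 1) by ring; eapply Rle_trans; [apply Cmod_triangle|].
      rewrite Cmod_1; unfold near1 in Mtau; lra. }
    pose proof (Cmod_ge_0 tau); nra. }
  assert (Mz : near1 (1 + z)).
  { unfold near1; replace (1 + z - 1) with z by ring; lra. }
  assert (BX : (Cmod X <= 16 * d)%R).
  { replace X with (4 * s / (1 + s) / (1 + s)) by (unfold X; field; assumption).
    replace (16 * d)%R with (2 * (2 * (4 * d)))%R by ring.
    apply Cmod_div_le; [|assumption]; apply Cmod_div_le; [|assumption].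
    rewrite Cmod_mult, Cmod_R, Rabs_pos_eq; lra. }
  assert (BY : (Cmod Y <= d)%R) by (unfold Y; rewrite Cmod_pow; simpl; nra).
  assert (Byy : (Cmod (X * (1 - Y)) <= 32 * d)%R).
  { rewrite Cmod_mult.
    assert (Cmod (1 - Y) <= 2)%R.
    { eapply Rle_trans; [apply Cmod_triangle|]; rewrite Cmod_1, Cmod_opp; lra. }
    pose proof (Cmod_ge_0 X); pose proof (Cmod_ge_0 (1 - Y)); nra. }
  destruct (S1 X Y) as [G0 [H0 [HG0 [HH0 H4]]]]; [lra | lra|].
  destruct (S2 (X * (1 - Y)) z) as [l [Hl H2]]; [lra | lra|].
  destruct (S3 X) as [g [Hg HgX]]; [lra|].
  (* [z^2 = Y (1 - X)] makes both F4 series the same one, so uniqueness of totals equates [l] with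
     the Bailey product, whose first factor Pfaff rewrites. *)
  assert (El : l = Cpower (1 - X) (- a) * g * H0).
  { rewrite <- (has_sum_unique _ _ _ (proj2 HG0) (proj2 HgX)).
    apply (has_sum_unique _ _ _ (proj2 Hl)).
    replace (z ^ 2) with (Y * (1 - X))
      by (unfold z, Y, X, tau; field; assumption).
    exact (proj2 H4). }
  assert (nz1 : 1 + z <> 0) by (apply Cmod_gt_0; pose proof (Cmod_1_add_ge z ltac:(lra)); lra).
  assert (ED : 1 + s + t - s * t = (1 + s) * (1 + z)) by (unfold z, tau; field; assumption).
  exists (Cpower (1 + z) (2 * a) * l), g, H0; repeat split.
  - replace (4 * (1 - s ^ 2) * t / (1 + s + t - s * t) ^ 2) with (4 * z / (1 + z) ^ 2).
    2:{ rewrite ED; replace (4 * z) with (4 * t * (1 - s) / (1 + s))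
          by (unfold z, tau; field; assumption).
        field; split; assumption. }
    replace (4 * (1 - Y) * s / (1 + s + t - s * t) ^ 2) with (X * (1 - Y) / (1 + z) ^ 2).
    2:{ rewrite ED; unfold X, Y; field; split; assumption. }
    exact (proj2 H2).
  - replace (- (4 * s / (s - 1) ^ 2)) with (X / (X - 1)).
    2:{ replace (X - 1) with (- (s - 1) ^ 2 / (1 + s) ^ 2) by (unfold X; field; assumption).
        unfold X; field; split; assumption. }
    replace (2 * b2 - b2) with b2 in Hg by ring; apply asum_is_series, Hg.
  - apply asum_is_series, HH0.
  - rewrite El, ED.
    replace ((1 + s) * (1 + z) / (1 - s)) with (sg * (1 + z)) by (unfold sg; field; assumption).
    replace (2 * b1 + 2 * b2 - 1) with (2 * a) by (unfold a; field).
    replace (1 - X) with (tau * tau) by (unfold X, tau; field; assumption).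
    (* The two numbers are inverse to each other; additivity of [Clog] applies because both are near
       1. *)
    assert (Ls : Clog sg = - Clog tau).
    { assert (E : Clog sg + Clog tau = 0).
      { rewrite <- Clog_mult by assumption.
        replace (sg * tau) with (RtoC 1) by (unfold sg, tau; field; split; assumption).
        replace (RtoC 1) with (Cexp 0) by apply Cexp_0; apply Clog_Cexp.
        simpl; pose proof PI_RGT_0; lra. }
      replace (Clog sg) with (Clog sg + Clog tau - Clog tau) by ring; rewrite E; ring. }
    (* As [1 - X = tau^2], the exponent [-2a Clog tau] is [2a Clog sg], and [Clog] is additive on
       [sg] and [1 + z]; hence no branch jump between the product of powers and the stated one. *)
    assert (Ep : Cpower (1 + z) (2 * a) * Cpower (tau * tau) (- a) = Cpower (sg * (1 + z)) (2 * a)).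
    { unfold Cpower; rewrite <- Cexp_plus, !Clog_mult, Ls by assumption; f_equal; ring. }
    rewrite <- Ep; ring.
Qed.
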